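(* Let $\Sigma$ be a Hopf cylinder in a BCV space $M^3(m,l)$, over an arclength-parametrized curve $\gamma(s)$ with horizontal lift of geodesic curvature $\kappa$. If the conformal immersion $\varphi:(\Sigma,\bar g=f^{-1}\varphi^*h)\to M^3(m,l)$ is proper biharmonic with nonconstant conformal factor $f^{1/2}$, then $l=0$, and either (i) the cylinder has nonzero constant mean curvature $H=\frac{\kappa}{2}$ satisfying $\kappa^2-4m>0$, and $f=d_1e^{z\sqrt{\kappa^2-4m}}+d_2e^{-z\sqrt{\kappa^2-4m}}$, where $d_1,d_2$ are constants with $d_1^2+d_2^2\ne0$ such that $f>0$; or (ii) the cylinder has nonconstant mean curvature $H=\frac{\kappa}{2}$, and $f=\psi(z)\kappa^{-3/2}(s)=\psi(z,K)\,\kappa^{-3/2}(s,m,K)$, where $K$ is a constant, $$\kappa(s)=\kappa(s,m,K)=\begin{cases} \dfrac{1}{C_1e^{2\sqrt{-(4m+K)}\,s}+D_1e^{-2\sqrt{-(4m+K)}\,s}+\sqrt{4C_1D_1+\frac{1}{4m+K}}}, & 4m+K<0,\\[3mm] \dfrac{4C_2}{16+C_2^2(s+D_2)^2}, & 4m+K=0,\\[3mm] \dfrac{1}{C_3\cos(2\sqrt{4m+K}\,s)+D_3\sin(2\sqrt{4m+K}\,s)+\sqrt{\frac{1}{4m+K}+(C_3^2+D_3^2)}}, & 4m+K>0, \end{cases}$$ and $$\psi(z)=\psi(z,K)=\begin{cases} a_3\sin(\sqrt{-K}\,z)+b_3\cos(\sqrt{-K}\,z), & K<0,\\ a_2z+b_2,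 & K=0,\\ a_1e^{\sqrt K z}+b_1e^{-\sqrt K z}, & K>0, \end{cases}$$ with $a_i,b_i,C_i,D_i$ ($i=1,2,3$) constants such that $\kappa$ is a nonconstant positive function and $\psi>0$.
   Context: For real constants $m,l$, the 3-dimensional Bianchi–Cartan–Vranceanu (BCV) space is $M^3(m,l)=\big(\mathbb{R}^3,\ h=\frac{dx^2+dy^2}{[1+m(x^2+y^2)]^2}+\big[dz+\frac l2\frac{y\,dx-x\,dy}{1+m(x^2+y^2)}\big]^2\big)$ (for $m<0$, on the region $1+m(x^2+y^2)>0$). The projection $\pi:M^3(m,l)\to\big(\mathbb{R}^2,h_1=\frac{dx^2+dy^2}{[1+m(x^2+y^2)]^2}\big)$, $\pi(x,y,z)=(x,y)$, is a Riemannian submersion with totally geodesic fibres, and $\partial_z$ is tangent to the fibres. For an immersed regular curve $\gamma:I\to(\mathbb{R}^2,h_1)$, $\gamma(s)=(x(s),y(s))$, parametrized by arclength, the Hopf cylinder is $\Sigma=\bigcup_{s\in I}\pi^{-1}(\gamma(s))$, viewed as the isometric immersion $\varphi(s,z)=(x(s),y(s),z)$ with induced metric $\varphi^*h$; its mean curvature is $H=\kappa/2$, where $\kappa$ is the geodesic curvature of a horizontal lift of $\gamma$. Here $f$ is a positive function on $\Sigma$; the conformal factor of $\varphi:(\Sigma,f^{-1}\varphi^*h)\to M^3(m,l)$ is $f^{1/2}$. A map $\varphi:(M,g)\to(N,h)$ is harmonic if $\tau(\varphi)=\mathrm{Trace}_g\nabla d\varphi=0$, biharmonic if $\tau_2(\varphi)=\mathrm{Trace}_g(\nabla^\varphi\nabla^\varphi-\nabla^\varphi_{\nabla^M})\tau(\varphi)-\mathrm{Trace}_g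 R^N(d\varphi,\tau(\varphi))d\varphi=0$ with $R^N(X,Y)Z=[\nabla^N_X,\nabla^N_Y]Z-\nabla^N_{[X,Y]}Z$, and proper biharmonic if biharmonic but not harmonic.
   Formalization: In the case 4m+K<0 the term √(4C₁D₁+1/(4m+K)) in κ(s) may carry either sign (with a nonnegative radicand); with the plus sign only the claim is false, e.g. m=−1, l=0, K=1, ψ=e^z, 1/κ=C e^{2√3 s}+D e^{−2√3 s}−√(4CD−1/3), where C,D>0 and 4CD>1/3. *)

(* Defs.v *)
From HB Require Import structures.
From mathcomp Require Import all_boot all_order all_algebra.
From mathcomp Require Import all_classical all_reals all_analysis.

Set Implicit Arguments.
Unset Strict Implicit.
Unset Printing Implicit Defensive.

Import Order.TTheory GRing.Theory Num.Theory.
Import numFieldNormedType.Exports.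

Local Open Scope classical_set_scope.
Local Open Scope ring_scope.

(* U is meant to be open; for a finite-dimensional domain this is C^k. *)
Fixpoint is_Ck (R : realType) (V W : normedModType R) (k : nat) (U : set V)
    (F : V -> W) : Prop :=
  (forall p, U p -> {for p, continuous F}) /\
  match k with
  | 0 => True
  | k'.+1 => forall v, (forall p, U p -> derivable F p v) /\ is_Ck k' U ('D_v F)
  end.

Definition smooth_on (R : realType) (V W : normedModType R) (U : set V)
    (F : V -> W) : Prop := forall k, is_Ck k U F.

Definition constant_on (T S : Type) (U : set T) (F : T -> S) : Prop :=
  exists c, forall p, U p -> F p = c.

(* Riemannian geometry in global coordinates: a metric on (an open subset of)
   R^n is the function giving its matrix of coefficients g_ij at each point.
   Definitions are total and only meaningful where the metric is. *)

Definition metric (R : realType) (n : nat) := 'rV[R]_n -> 'M[R]_n.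

Definition coord_field (R : realType) (n : nat) (i : 'I_n) :
    'rV[R]_n -> 'rV[R]_n := fun=> delta_mx 0 i.

Definition inner (R : realType) (n : nat) (g : metric R n) (p u v : 'rV[R]_n) : R :=
  (u *m g p *m v^T) 0 0.

Definition partial (R : realType) (n : nat) (i : 'I_n) (F : 'rV[R]_n -> R)
    (p : 'rV[R]_n) : R := 'D_(delta_mx 0 i) F p.

(* Gamma^k_ij *)
Definition christoffel (R : realType) (n : nat) (g : metric R n)
    (p : 'rV[R]_n) (k i j : 'I_n) : R :=
  2^-1 * \sum_(r < n) invmx (g p) k r *
    (partial i (fun q => g q j r) p + partial j (fun q => g q i r) p
     - partial r (fun q => g q i j) p).

Definition christoffel_form (R : realType) (n : nat) (g : metric R n)
    (p u v : 'rV[R]_n) : 'rV[R]_n :=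
  \row_k \sum_(i < n) \sum_(j < n) christoffel g p k i j * u 0 i * v 0 j.

(* (nabla^phi_X V)(p), for V a section of phi^-1 TN and X a vector field on
   the domain of phi. *)
Definition nabla_along (R : realType) (M : normedModType R) (n : nat)
    (h : metric R n) (phi : M -> 'rV[R]_n) (X : M -> M) (V : M -> 'rV[R]_n)
    (p : M) : 'rV[R]_n :=
  'D_(X p) V p + christoffel_form h (phi p) ('D_(X p) phi p) (V p).

Definition nabla (R : realType) (n : nat) (g : metric R n)
    (X Y : 'rV[R]_n -> 'rV[R]_n) : 'rV[R]_n -> 'rV[R]_n :=
  nabla_along g id X Y.

Definition lie_bracket (R : realType) (n : nat) (X Y : 'rV[R]_n -> 'rV[R]_n)
    (p : 'rV[R]_n) : 'rV[R]_n := 'D_(X p) Y p - 'D_(Y p) X p.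

Definition curvature (R : realType) (n : nat) (g : metric R n)
    (X Y Z : 'rV[R]_n -> 'rV[R]_n) (p : 'rV[R]_n) : 'rV[R]_n :=
  nabla g X (nabla g Y Z) p - nabla g Y (nabla g X Z) p
  - nabla g (lie_bracket X Y) Z p.

(* The curvature is tensorial, so its value on tangent vectors at p is computed
   on their extensions with constant coefficients. *)
Definition curvature_at (R : realType) (n : nat) (g : metric R n)
    (p u v w : 'rV[R]_n) : 'rV[R]_n :=
  curvature g (fun=> u) (fun=> v) (fun=> w) p.

Definition trace_metric (R : realType) (m n : nat) (g : metric R m)
    (p : 'rV[R]_m) (B : 'I_m -> 'I_m -> 'rV[R]_n) : 'rV[R]_n :=
  \sum_(i < m) \sum_(j < m) invmx (g p) i j *: B i j.

(* (nabla d phi)(X, Y) *)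
Definition hess_map (R : realType) (m n : nat) (g : metric R m) (h : metric R n)
    (phi : 'rV[R]_m -> 'rV[R]_n) (X Y : 'rV[R]_m -> 'rV[R]_m)
    (p : 'rV[R]_m) : 'rV[R]_n :=
  nabla_along h phi X (fun q => 'D_(Y q) phi q) p - 'D_(nabla g X Y p) phi p.

Definition tension (R : realType) (m n : nat) (g : metric R m) (h : metric R n)
    (phi : 'rV[R]_m -> 'rV[R]_n) (p : 'rV[R]_m) : 'rV[R]_n :=
  trace_metric g p
    (fun i j => hess_map g h phi (coord_field i) (coord_field j) p).

(* nabla^phi_X nabla^phi_Y V - nabla^phi_(nabla^M_X Y) V *)
Definition nabla2_along (R : realType) (m n : nat) (g : metric R m)
    (h : metric R n) (phi : 'rV[R]_m -> 'rV[R]_n) (X Y : 'rV[R]_m -> 'rV[R]_m)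
    (V : 'rV[R]_m -> 'rV[R]_n) (p : 'rV[R]_m) : 'rV[R]_n :=
  nabla_along h phi X (nabla_along h phi Y V) p
  - nabla_along h phi (nabla g X Y) V p.

Definition bitension (R : realType) (m n : nat) (g : metric R m) (h : metric R n)
    (phi : 'rV[R]_m -> 'rV[R]_n) (p : 'rV[R]_m) : 'rV[R]_n :=
  trace_metric g p (fun i j =>
    nabla2_along g h phi (coord_field i) (coord_field j)
      (tension g h phi) p)
  - trace_metric g p (fun i j =>
      curvature_at h (phi p) ('D_(delta_mx 0 i) phi p) (tension g h phi p)
        ('D_(delta_mx 0 j) phi p)).

Definition harmonic_on (R : realType) (m n : nat) (U : set 'rV[R]_m)
    (g : metric R m) (h : metric R n) (phi : 'rV[R]_m -> 'rV[R]_n) : Prop :=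
  forall p, U p -> tension g h phi p = 0.

Definition biharmonic_on (R : realType) (m n : nat) (U : set 'rV[R]_m)
    (g : metric R m) (h : metric R n) (phi : 'rV[R]_m -> 'rV[R]_n) : Prop :=
  forall p, U p -> bitension g h phi p = 0.

Definition proper_biharmonic_on (R : realType) (m n : nat) (U : set 'rV[R]_m)
    (g : metric R m) (h : metric R n) (phi : 'rV[R]_m -> 'rV[R]_n) : Prop :=
  biharmonic_on U g h phi /\ ~ harmonic_on U g h phi.

Definition pullback_metric (R : realType) (m n : nat) (h : metric R n)
    (phi : 'rV[R]_m -> 'rV[R]_n) : metric R m :=
  fun p => \matrix_(i, j)
    inner h (phi p) ('D_(delta_mx 0 i) phi p) ('D_(delta_mx 0 j) phi p).

(* Length of the mean curvature vector (1/m) Trace (nabla d phi) of the immersion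
   phi with its induced metric, i.e. the mean curvature with respect to the unit
   normal that makes it nonnegative. *)
Definition mean_curvature (R : realType) (m n : nat) (h : metric R n)
    (phi : 'rV[R]_m -> 'rV[R]_n) (p : 'rV[R]_m) : R :=
  let t := m%:R^-1 *: tension (pullback_metric h phi) h phi p in
  Num.sqrt (inner h (phi p) t t).

(* |nabla_(c') c'|, for c parametrized by arclength. *)
Definition geodesic_curvature (R : realType) (n : nat) (h : metric R n)
    (c : R -> 'rV[R]_n) (s : R) : R :=
  let a := nabla_along h c (fun=> 1) (derive1 c) s in
  Num.sqrt (inner h (c s) a a).

Definition vec2 (R : realType) (a b : R) : 'rV[R]_2 := \row_i [:: a; b]`_i.

Definition vec3 (R : realType) (a b c : R) : 'rV[R]_3 := \row_i [:: a; b; c]`_i.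

Definition bcv_factor (R : realType) (m x y : R) : R := 1 + m * (x ^+ 2 + y ^+ 2).

Definition bcv_base_metric (R : realType) (m : R) : metric R 2 := fun p =>
  (bcv_factor m (p 0 0) (p 0 1) ^- 2) *: 1%:M.

(* dz + (l/2) (y dx - x dy) / (1 + m (x^2 + y^2)) *)
Definition bcv_form (R : realType) (m l : R) (p : 'rV[R]_3) : 'rV[R]_3 :=
  let x := p 0 0 in let y := p 0 1 in
  vec3 (l / 2 * y / bcv_factor m x y) (- (l / 2 * x / bcv_factor m x y)) 1.

Definition bcv_metric (R : realType) (m l : R) : metric R 3 := fun p =>
  let dx := vec3 1 0 0 in let dy := vec3 0 1 0 in
  (bcv_factor m (p 0 0) (p 0 1) ^- 2) *: (dx^T *m dx + dy^T *m dy)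
  + (bcv_form m l p)^T *m bcv_form m l p.

Definition bcv_proj (R : realType) (p : 'rV[R]_3) : 'rV[R]_2 :=
  vec2 (p 0 0) (p 0 1).

(* For m >= 0 the positivity condition holds automatically. *)
Definition arclength_curve (R : realType) (m : R) (I : set R)
    (gamma : R -> 'rV[R]_2) : Prop :=
  [/\ smooth_on I gamma,
      forall s, I s -> 0 < bcv_factor m (gamma s 0 0) (gamma s 0 1)
    & forall s, I s ->
        inner (bcv_base_metric m) (gamma s) (derive1 gamma s) (derive1 gamma s) = 1].

Definition horizontal_lift (R : realType) (m l : R) (I : set R)
    (gamma : R -> 'rV[R]_2) (c : R -> 'rV[R]_3) : Prop :=
  [/\ smooth_on I c,
      forall s, I s -> bcv_proj (c s) = gamma s
    & forall s, I s -> inner (bcv_metric m l) (c s) (derive1 c s) (vec3 0 0 1) = 0].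

Definition hopf_domain (R : realType) (I : set R) : set 'rV[R]_2 :=
  [set q | I (q 0 0)].

Definition hopf_cylinder (R : realType) (gamma : R -> 'rV[R]_2)
    (q : 'rV[R]_2) : 'rV[R]_3 :=
  vec3 (gamma (q 0 0) 0 0) (gamma (q 0 0) 0 1) (q 0 1).

Definition conformal_metric (R : realType) (n : nat) (f : 'rV[R]_n -> R)
    (g : metric R n) : metric R n := fun p => (f p)^-1 *: g p.

(* In the case 4m + K < 0 the square root of 4 C D + 1 / (4m + K) stands for
   either of its determinations, selected by e (e = false is the nonnegative
   one): 1/kappa solves v'' + 4 c v = 2 E and v'^2 = 4 E v - 4 c v^2 - 4 with
   c = 4m + K, and E / (2 c) can have either sign when c < 0. *)
Definition kappa_sol (R : realType) (m K C D : R) (e : bool) (s : R) : R :=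
  let c := 4 * m + K in
  if c < 0 then
    (C * expR (2 * Num.sqrt (- c) * s) + D * expR (- (2 * Num.sqrt (- c) * s))
     + (-1) ^+ e * Num.sqrt (4 * C * D + c^-1))^-1
  else if c == 0 then 4 * C / (16 + C ^+ 2 * (s + D) ^+ 2)
  else
    (C * cos (2 * Num.sqrt c * s) + D * sin (2 * Num.sqrt c * s)
     + Num.sqrt (c^-1 + (C ^+ 2 + D ^+ 2)))^-1.

Definition psi_sol (R : realType) (K a b z : R) : R :=
  if K < 0 then a * sin (Num.sqrt (- K) * z) + b * cos (Num.sqrt (- K) * z)
  else if K == 0 then a * z + b
  else a * expR (Num.sqrt K * z) + b * expR (- (Num.sqrt K * z)).

(* Main.v *)
(** Along the cylinder, the horizontal lifts [X], [xi] of the unit tangent and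
    normal of the base curve and the vertical field [V] form an orthonormal frame
    whose structure equations involve only [tau = l / 2] and the signed curvature
    [k] of the curve. By conformal invariance in dimension two, the tension field
    is [u xi] with [u = f k], and the bitension field is [f] times
      [(2 tau V u - 2 k X u - u k') X + (2 tau X u) V
       + (X X u + V V u - u (k^2 + 4 tau^2 - 4 m)) xi].

    If [tau <> 0] then [X u = 0] and [V u = (k' / (2 tau)) u]; hence [u] is
    exponential along the rulings with a rate that cannot depend on [s], the
    normal equation makes [k] constant, and then [u] and [f] are constant.

    If [tau = 0], the tangential equation says that [f^2 k^3] does not depend on
    [s], so [k] vanishes nowhere and [f = psi(z) |k|^(-3/2)]. The normal equation
    separates into [psi'' = K psi] and, for [v = 1 / |k|] and [c = 4 m + K], into
    [v'' = 2 E - 4 c v] with first integral [v'^2 = 4 E v - 4 c v^2 - 4]. *)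

Require Import Defs.
From HB Require Import structures.
From mathcomp Require Import all_boot all_order all_algebra.
From mathcomp Require Import all_classical all_reals all_analysis.
From mathcomp Require Import ring lra.
Import Order.TTheory GRing.Theory Num.Theory.
Import numFieldNormedType.Exports.
Local Open Scope classical_set_scope.
Local Open Scope ring_scope.
Set Implicit Arguments.
Unset Strict Implicit.
Unset Printing Implicit Defensive.

(** * Directional derivatives *)

(** The parametrization by [(s, z)] is not adapted to the frame: [d/ds = X + a V], where [a] is the
    function [slope]. Thus [X] acts as [d/ds - a d/dz], its integral curves are the horizontal lifts
    of the base curve, and [X u = 0] says that [u] is constant along them.

    Non-harmonicity gives [k <> 0] at a single point only, so no equation may be divided by [k]
    before this is spread over the whole interval. If [l <> 0], transport of [u] along a horizontal
    lift does it; if [l = 0], the conserved quantity [f^2 k^3] does it, and its odd power of [k]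
    also fixes the sign. The latter matters because the curvature of the statement is [|k|], to
    which the differential equations pass once the sign of [k] is known to be constant.

    The constant [K] is the quotient [f_zz / f], which the product form of [f] makes independent of
    [s] and the normal equation independent of [z]. When [k] is constant, positivity of [psi] on a
    complete ruling leaves only [K > 0] or [psi] constant, and the latter is excluded by hypothesis.

    Smoothness is given through derivatives in fixed directions, so their linearity in the direction
    has to be established before frames can be differentiated. *)

Section DirectionalDerivatives.
Context {R : realType}.
Implicit Types V W : normedModType R.

Lemma is_derive_fctD V (f g : V -> R) x v df dg :
  is_derive x v f df -> is_derive x v g dg ->
  is_derive x v (fun y => f y + g y) (df + dg).
Proof. exact: is_deriveD. Qed.

Lemma is_derive_fctN V (f : V -> R) x v df :
  is_derive x v f df -> is_derive x v (fun y => - f y) (- df).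
Proof. exact: is_deriveN. Qed.

Lemma is_derive_fctM V (f g : V -> R) x v df dg :
  is_derive x v f df -> is_derive x v g dg ->
  is_derive x v (fun y => f y * g y) (f x * dg + g x * df).
Proof. exact: is_deriveM. Qed.

Lemma is_derive_fctX V (f : V -> R) n x v df :
  is_derive x v f df ->
  is_derive x v (fun y => f y ^+ n) (n%:R * f x ^+ n.-1 * df).
Proof.
move=> fdf; have := @is_deriveX R V f n x v df fdf.
by rewrite (_ : f ^+ n = (fun y => f y ^+ n)) // fctE.
Qed.

Lemma is_derive_fctV V (f : V -> R) x v df : f x != 0 ->
  is_derive x v f df -> is_derive x v (fun y => (f y)^-1) (- (f x) ^- 2 * df).
Proof.
move=> f0 [fx <-]; apply: DeriveDef; first exact: derivableV.
by rewrite deriveV.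
Qed.

Lemma is_derive_fct_cst V (c : R) (x v : V) : is_derive x v (fun=> c) 0.
Proof. exact: is_derive_cst. Qed.

Lemma is_derive_mxP V m n (M : V -> 'M[R]_(m, n)) x v dM :
  is_derive x v M dM <->
  forall i j, is_derive x v (fun y => M y i j) (dM i j).
Proof.
split=> [[Mx <-] i j|Mx].
  apply: DeriveDef; first by move/derivable_mxP : Mx; exact.
  by rewrite derive_mx // mxE.
have dMx : derivable M x v by apply/derivable_mxP => i j; case: (Mx i j).
apply: DeriveDef => //; rewrite derive_mx //; apply/matrixP => i j.
by rewrite mxE; case: (Mx i j).
Qed.

Lemma is_derive_coord n (q v : 'rV[R]_n) i :
  is_derive q v (fun p : 'rV[R]_n => p 0 i) (v 0 i).
Proof. by have /is_derive_mxP := is_derive_id q v; exact. Qed.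

Lemma vec3_0 (a b c : R) : vec3 a b c 0 0 = a. Proof. by rewrite mxE. Qed.
Lemma vec3_1 (a b c : R) : vec3 a b c 0 1 = b. Proof. by rewrite mxE. Qed.
Lemma vec3_2 (a b c : R) : vec3 a b c 0 2 = c. Proof. by rewrite mxE. Qed.
Definition vec3E := (vec3_0, vec3_1, vec3_2).
Lemma vec2_0 (a b : R) : vec2 a b 0 0 = a. Proof. by rewrite mxE. Qed.
Lemma vec2_1 (a b : R) : vec2 a b 0 1 = b. Proof. by rewrite mxE. Qed.
Definition vec2E := (vec2_0, vec2_1).

Lemma ord3P (i : 'I_3) : [\/ i = 0, i = 1 | i = 2].
Proof.
case: i => [[|[|[|//]]] h]; [constructor 1|constructor 2|constructor 3];
  exact: val_inj.
Qed.

Lemma ord2P (i : 'I_2) : i = 0 \/ i = 1.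
Proof. by case: i => [[|[|//]] h]; [left|right]; exact: val_inj. Qed.

Lemma row3P (u v : 'rV[R]_3) :
  u 0 0 = v 0 0 -> u 0 1 = v 0 1 -> u 0 2 = v 0 2 -> u = v.
Proof. by move=> ? ? ?; apply/rowP => i; case: (ord3P i) => ->. Qed.

Lemma row2P (u v : 'rV[R]_2) : u 0 0 = v 0 0 -> u 0 1 = v 0 1 -> u = v.
Proof. by move=> ? ?; apply/rowP => i; case: (ord2P i) => ->. Qed.

Lemma row2_vec2 (u : 'rV[R]_2) : u = vec2 (u 0 0) (u 0 1).
Proof. by apply: row2P; rewrite !vec2E. Qed.

Lemma is_derive_vec3 V (a b c : V -> R) x v da db dc :
  is_derive x v a da -> is_derive x v b db -> is_derive x v c dc ->
  is_derive x v (fun y => vec3 (a y) (b y) (c y)) (vec3 da db dc).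
Proof.
move=> ax bx cx; apply/is_derive_mxP => i j; rewrite (ord1 i).
have [->|[->|->]] : j = 0 \/ j = 1 \/ j = 2 by case: (ord3P j); auto.
- by rewrite vec3E; under eq_fun do rewrite vec3E.
- by rewrite vec3E; under eq_fun do rewrite vec3E.
- by rewrite vec3E; under eq_fun do rewrite vec3E.
Qed.

(** Restriction to a line brings the one-variable chain rule and mean value theorem to bear on
    directional derivatives. *)
Lemma is_derive_line V W (f : V -> W) x v df :
  is_derive x v f df <-> is_derive (0 : R) 1 (fun h : R => f (h *: v + x)) df.
Proof.
have E : 'D_v f x = 'D_1 (fun h : R => f (h *: v + x)) 0.
  rewrite /derive; set g1 := fun h => h^-1 *: _; set g2 := fun h => h^-1 *: _.
  suff -> : g1 = g2 by [].
  by apply/funext => h; rewrite /g1 /g2 /= addr0 scale0r add0r [_%:A]mulr1.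
by split=> -[fx <-]; apply: DeriveDef; rewrite ?E //; [move/derivable1P :
  fx|apply/derivable1P].
Qed.

Lemma is_derive_comp_fct V (f : R -> R) (g : V -> R) x v df dg :
  is_derive (g x) 1 f df -> is_derive x v g dg ->
  is_derive x v (fun y => f (g y)) (df * dg).
Proof.
move=> fx /is_derive_line gx; apply/is_derive_line.
by apply: (@is_derive1_comp _ f (fun h : R => g (h *: v + x))) gx;
   rewrite scale0r add0r.
Qed.

Lemma is_derive_curve2l (f : 'rV[R]_2 -> R) (s z d : R) :
  is_derive (vec2 s z) (delta_mx 0 0) f d ->
  is_derive s 1 (fun t => f (vec2 t z)) d.
Proof.
move/is_derive_line => fd; apply/is_derive_line.
have -> // : (fun h : R => f (vec2 (h *: 1 + s) z)) =
  (fun h : R => f (h *: delta_mx 0 0 + vec2 s z)).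
apply/funext => h; congr f; apply: row2P; by rewrite !mxE /= ?mulr0 ?add0r.
Qed.

Lemma is_derive_curve2r (f : 'rV[R]_2 -> R) (s z d : R) :
  is_derive (vec2 s z) (delta_mx 0 1) f d ->
  is_derive z 1 (fun t => f (vec2 s t)) d.
Proof.
move/is_derive_line => fd; apply/is_derive_line.
have -> // : (fun h : R => f (vec2 s (h *: 1 + z))) =
  (fun h : R => f (h *: delta_mx 0 1 + vec2 s z)).
apply/funext => h; congr f; apply: row2P; by rewrite !mxE /= ?mulr0 ?add0r.
Qed.

Lemma is_derive_scale V (f : V -> R) x v df (a : R) :
  is_derive x v f df -> is_derive x (a *: v) f (a * df).
Proof.
move=> /is_derive_line fx; apply/is_derive_line; rewrite mulrC.
under eq_fun do rewrite scalerA.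
apply: (@is_derive_comp_fct R (fun h => f (h *: v + x)) (fun h => h * a)).
  by rewrite mul0r.
have := @is_derive_fctM R^o id (cst a) 0 1 1 0 _ _.
by rewrite /= mulr0 mulr1 add0r; apply.
Qed.

Lemma is_derive_cvg V W (f : V -> W) x v df :
  h^-1 *: (f (h *: v + x) - f x) @[h --> (0 : R)^'] --> df ->
  is_derive x v f df.
Proof.
move=> fx; apply: DeriveDef; last exact/cvg_lim.
by apply/cvg_ex; exists df.
Qed.

(* The mean value theorem in the direction [w] compares the increment of [f]
  from
   [x + h v] to [x + h (v + w)] with [h 'D_w f x]. *)
Lemma is_derive_directionD V (f : V -> R) x v w df :
  is_derive x v f df ->
  (\forall y \near x, derivable f y w) -> {for x, continuous ('D_w f)} ->
  is_derive x (v + w) f (df + 'D_w f x).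
Proof.
move=> [fv <-] fw cw; apply: is_derive_cvg; rewrite [X in _ --> X]addrC.
rewrite [X in X @ _](_ : _ =
  (fun h : R => h^-1 *: (f (h *: (v + w) + x) - f (h *: v + x))) \+
  (fun h : R => h^-1 *: (f (h *: v + x) - f x))); last first.
  by apply/funext => h /=; rewrite -scalerDr addrA subrK.
apply: cvgD; last exact: fv.
apply/cvgrPdist_le => e e0.
have : \forall y \near x, derivable f y w /\ `|'D_w f x - 'D_w f y| <= e.
  near=> y; split; first by near: y.
  by near: y; move/cvgrPdist_le : cw; exact.
move=> /nbhs_normP[r /= r0 rP].
(* For [|h|] below this bound the whole segment from [x + h v] to [x + h (v + w)] stays in the ball
   of radius [r]; the [1] keeps the denominator positive when [v = w = 0]. *)
have d0 : 0 < r / (`|v| + `|w| + 1).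
  by rewrite divr_gt0 // ltr_wpDl ?addr_ge0.
near=> h.
have hd : `|h| < r / (`|v| + `|w| + 1) by near: h; exact: dnbhs0_lt.
have h0 : h != 0 by near: h; exact: nbhs_dnbhs_neq.
have P (t : R) : 0 <= t <= 1 -> derivable f ((t * h) *: w + (h *: v + x)) w /\
    `|'D_w f x - 'D_w f ((t * h) *: w + (h *: v + x))| <= e.
  move=> /andP[t0 t1]; apply: rP; rewrite /ball_ /= distrC addrA addrK.
  apply: (le_lt_trans (ler_normD _ _)); rewrite !normrZ (ger0_norm t0).
  move: hd; rewrite ltr_pdivlMr ?ltr_wpDl ?addr_ge0 //; apply: le_lt_trans.
  have hw : t * `|h| * `|w| <= `|h| * `|w|.
    by rewrite -mulrA ler_piMl // mulr_ge0.
  by rewrite !mulrDr mulr1; have := normr_ge0 h; lra.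
pose phi (t : R) := f ((t * h) *: w + (h *: v + x)).
have dphi (t : R) : 0 <= t <= 1 ->
    is_derive t 1 phi ('D_w f ((t * h) *: w + (h *: v + x)) * h).
  move=> /P[/derivableP/(is_derive_scale h)/is_derive_line Pt _].
  apply/is_derive_line; rewrite mulrC (_ : (fun u : R => phi (u *: 1 + t)) =
    (fun u : R => f (u *: (h *: w) + ((t * h) *: w + (h *: v + x))))) //.
  apply/funext => u.
  by rewrite /phi [u *: 1]mulr1 mulrDl scalerDl -(addrA (u * h *: w)) scalerA.
have [t tin] : exists2 t : R, t \in `]0, 1[%R & phi 1 - phi 0 =
    'D_w f ((t * h) *: w + (h *: v + x)) * h * (1 - 0).
  apply: (@MVT R phi (fun t => 'D_w f ((t * h) *: w + (h *: v + x)) * h)) => //.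
    by move=> t /itvP tI; apply: dphi; rewrite !tI.
  apply: derivable_within_continuous => t /itvP tI.
  by case: (dphi t); rewrite ?tI.
rewrite subr0 mulr1 /phi mul1r mul0r scale0r add0r addrA -scalerDr (addrC w).
move=> ->; rewrite [_ *: _]mulrC mulfK //.
by have /itvP tI := tin; have [|_ //] := P t; rewrite !tI.
Unshelve. all: by end_near. Qed.

End DirectionalDerivatives.

(* Differentiates by syntactic recursion, with hypotheses as leaves.  Type class
   resolution is switched off: its instances would state the derivative with
     [*:]. *)
Ltac isderive :=
  lazymatch goal with
  | |- is_derive _ _ (fun _ => ?c) _ =>
      notypeclasses refine (is_derive_fct_cst _ _ _)
  | |- is_derive _ _ (fun y => y) _ => notypeclasses refine (is_derive_id _ _)
  | |- is_derive _ _ (fun y => @?f y + @?g y) _ =>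
      notypeclasses refine (@is_derive_fctD _ _ f g _ _ _ _ _ _); isderive
  | |- is_derive _ _ (fun y => - @?f y) _ =>
      notypeclasses refine (@is_derive_fctN _ _ f _ _ _ _); isderive
  | |- is_derive _ _ (fun y => @?f y * @?g y) _ =>
      notypeclasses refine (@is_derive_fctM _ _ f g _ _ _ _ _ _); isderive
  | |- is_derive _ _ (fun y => @?f y ^+ _) _ =>
      notypeclasses refine (@is_derive_fctX _ _ f _ _ _ _ _); isderive
  | |- is_derive _ _ (fun y => (@?f y)^-1) _ =>
      notypeclasses refine (@is_derive_fctV _ _ f _ _ _ _ _);
      [try assumption | isderive]
  | |- is_derive _ _ (fun y => vec3 (@?a y) (@?b y) (@?c y)) _ =>
      notypeclasses refine (@is_derive_vec3 _ _ a b c _ _ _ _ _ _ _ _);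
      isderive
  | |- is_derive _ _ (fun y => fun_of_matrix y _ _) _ =>
      notypeclasses refine (is_derive_coord _ _ _)
  | |- _ => try eassumption
  end.

Ltac isderive_eq :=
  notypeclasses refine (is_derive_eq _ _); [isderive | rewrite /=].

(** * Christoffel symbols of the BCV metric *)

Section BCV.
Context {R : realType} (m l : R).
Implicit Types p u v w : 'rV[R]_3.

Local Notation F p := (bcv_factor m (p 0 0) (p 0 1)).
Local Notation theta p := (bcv_form m l p 0).
Local Notation h := (bcv_metric m l).

Lemma sum_ord3 (f : 'I_3 -> R) : \sum_(i < 3) f i = f 0 + f 1 + f 2.
Proof.
rewrite !big_ord_recl big_ord0 addr0 addrA.
by congr (_ + f _ + f _); exact: val_inj.
Qed.

Lemma sum_ord2 (V : nmodType) (f : 'I_2 -> V) : \sum_(i < 2) f i = f 0 + f 1.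
Proof.
rewrite !big_ord_recl big_ord0 addr0.
by congr (_ + f _); exact: val_inj.
Qed.

(* The pairing of [bcv_form m l p] with [u]. *)
Definition contact p u := l / 2 * (p 0 1 * u 0 0 - p 0 0 * u 0 1) / F p + u 0 2.

Lemma bcv_metricE p i j : h p i j =
  F p ^- 2 * (vec3 1 0 0 0 i * vec3 1 0 0 0 j + vec3 0 1 0 0 i * vec3 0 1 0 0 j)
  + theta p i * theta p j.
Proof. by rewrite /bcv_metric !mxE !big_ord1 !mxE. Qed.

Lemma inner_bcv p u v : inner h p u v =
  (u 0 0 * v 0 0 + u 0 1 * v 0 1) / F p ^+ 2 + contact p u * contact p v.
Proof.
rewrite /inner /contact !mxE sum_ord3 !mxE !sum_ord3 !bcv_metricE /bcv_form
  !vec3E.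
by ring.
Qed.

Lemma is_derive_bcv_factor p v : is_derive p v (fun q => F q)
  (2 * m * (p 0 0 * v 0 0 + p 0 1 * v 0 1)).
Proof. by rewrite /bcv_factor; isderive_eq; ring. Qed.

Definition dcontact p w u :=
  l / 2 * ((w 0 1 * u 0 0 - w 0 0 * u 0 1) / F p
    - (p 0 1 * u 0 0 - p 0 0 * u 0 1)
      * (2 * m * (p 0 0 * w 0 0 + p 0 1 * w 0 1)) / F p ^+ 2).

Lemma is_derive_contact p w u : F p != 0 ->
  is_derive p w (fun q => contact q u) (dcontact p w u).
Proof.
move=> F0; have dF := is_derive_bcv_factor p w.
by rewrite /contact; isderive_eq; rewrite /dcontact; field.
Qed.

Definition dinner p w u v :=
  - 2 * (2 * m * (p 0 0 * w 0 0 + p 0 1 * w 0 1)) / F p ^+ 3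
    * (u 0 0 * v 0 0 + u 0 1 * v 0 1)
  + dcontact p w u * contact p v + contact p u * dcontact p w v.

Lemma bcv_metric_inner p i j : h p i j = inner h p (delta_mx 0 i) (delta_mx 0
  j).
Proof.
rewrite inner_bcv bcv_metricE /contact.
by case: (ord3P i) => ->; case: (ord3P j) => ->; rewrite /bcv_form !vec3E !mxE
  /=; ring.
Qed.

Lemma is_derive_bcv_metric p w i j : F p != 0 ->
  is_derive p w (fun q => h q i j)
    (dinner p w (delta_mx 0 i) (delta_mx 0 j)).
Proof.
move=> F0; under eq_fun do rewrite bcv_metric_inner inner_bcv.
have dF := is_derive_bcv_factor p w.
have dci := is_derive_contact w (delta_mx 0 i) F0.
have dcj := is_derive_contact w (delta_mx 0 j) F0.
have F20 : F p ^+ 2 != 0 by rewrite expf_neq0.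
by isderive_eq; rewrite /dinner; field.
Qed.

(** The dual metric is the sum of the squares of the orthonormal frame [F (d/dx - a d/dz)],
    [F (d/dy - b d/dz)], [d/dz]. *)
Definition bcv_inv p i j : R :=
  let a := theta p 0 in let b := theta p 1 in
  F p ^+ 2 * (vec3 1 0 (- a) 0 i * vec3 1 0 (- a) 0 j
              + vec3 0 1 (- b) 0 i * vec3 0 1 (- b) 0 j)
  + vec3 0 0 1 0 i * vec3 0 0 1 0 j.

Lemma invmx_bcv p i j : F p != 0 -> invmx (h p) i j = bcv_inv p i j.
Proof.
move=> F0; pose B := bcv_inv p.
suff AB : h p *m (\matrix_(i, j) B i j) = 1%:M.
  have [Au _] := mulmx1_unit AB.
  suff -> : invmx (h p) = \matrix_(i, j) B i j by rewrite mxE.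
  by rewrite -[RHS]mul1mx -(mulVmx Au) -mulmxA AB mulmx1.
apply/matrixP => r c; rewrite [LHS]mxE sum_ord3 !bcv_metricE.
rewrite ![(\matrix_(_, _) _) _ _]mxE [RHS]mxE /B /bcv_inv.
by case: (ord3P r) => ->; case: (ord3P c) => ->; rewrite /bcv_form !vec3E /=;
  field.
Qed.

(* The Levi-Civita connection of the orthonormal frame
   [F (d/dx - A d/dz), F (d/dy - B d/dz), d/dz], with [bcv_form = (A, B, 1)],
   rewritten in coordinates. *)
Definition gamma0 p u v :=
  let x := p 0 0 in let y := p 0 1 in
  2 * m / F p * (- (x * u 0 0 * v 0 0) - y * u 0 1 * v 0 0
              - y * u 0 0 * v 0 1 + x * u 0 1 * v 0 1)
  + l / 2 * (u 0 1 * contact p v + v 0 1 * contact p u).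

Definition gamma1 p u v :=
  let x := p 0 0 in let y := p 0 1 in
  2 * m / F p * (y * u 0 0 * v 0 0 - x * u 0 0 * v 0 1
              - x * u 0 1 * v 0 0 - y * u 0 1 * v 0 1)
  - l / 2 * (u 0 0 * contact p v + v 0 0 * contact p u).

Definition gamma2 p u v :=
  let x := p 0 0 in let y := p 0 1 in
  l * m / (2 * F p ^+ 2) *
    (- (2 * x * y * u 0 0 * v 0 0)
     + (x ^+ 2 - y ^+ 2) * (u 0 0 * v 0 1 + u 0 1 * v 0 0)
     + 2 * x * y * u 0 1 * v 0 1)
  - l / 2 * (y * gamma0 p u v - x * gamma1 p u v) / F p.

Definition bcv_gamma p u v := vec3 (gamma0 p u v) (gamma1 p u v) (gamma2 p u v).

Lemma christoffel_form_bcv p u v : F p != 0 ->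
  christoffel_form h p u v = bcv_gamma p u v.
Proof.
move=> F0; rewrite /christoffel_form /christoffel /partial.
have dh r i j : 'D_(delta_mx 0 r) (fun q => h q i j) p
    = dinner p (delta_mx 0 r) (delta_mx 0 i) (delta_mx 0 j).
  by apply: derive_val; exact: is_derive_bcv_metric.
(* The Christoffel symbols with lowered index, up to the factor [2^-1]. Contracting them with [u]
   and [v] before raising the index leaves one identity per component instead of one per symbol. *)
pose N i j r := dinner p (delta_mx 0 i) (delta_mx 0 j) (delta_mx 0 r)
  + dinner p (delta_mx 0 j) (delta_mx 0 i) (delta_mx 0 r)
  - dinner p (delta_mx 0 r) (delta_mx 0 i) (delta_mx 0 j).
have NE r : \sum_(i < 3) \sum_(j < 3) N i j r * u 0 i * v 0 j =
    dinner p u v (delta_mx 0 r) + dinner p v u (delta_mx 0 r)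
    - dinner p (delta_mx 0 r) u v.
  rewrite !sum_ord3 /N /dinner /dcontact /contact.
  by case: (ord3P r) => ->; rewrite !mxE /=; field.
have GE k : (\row_k \sum_(i < 3) \sum_(j < 3) (2^-1 * \sum_(r < 3)
      invmx (h p) k r * ('D_(delta_mx 0 i) (fun q => h q j r) p
      + 'D_(delta_mx 0 j) (fun q => h q i r) p
      - 'D_(delta_mx 0 r) (fun q => h q i j) p)) * u 0 i * v 0 j) 0 k =
    2^-1 * \sum_(r < 3) bcv_inv p k r *
      (dinner p u v (delta_mx 0 r) + dinner p v u (delta_mx 0 r)
       - dinner p (delta_mx 0 r) u v).
  rewrite mxE; under [in RHS]eq_bigr do rewrite -NE.
  transitivity (\sum_(i < 3) \sum_(j < 3)
      (2^-1 * \sum_(r < 3) bcv_inv p k r * N i j r) * u 0 i * v 0 j).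
    apply: eq_bigr => i _; apply: eq_bigr => j _; congr (_ * _ * _ * _).
    by apply: eq_bigr => r _; rewrite invmx_bcv // !dh.
  by rewrite !sum_ord3; ring.
apply: row3P; rewrite GE sum_ord3 /bcv_inv /dinner /dcontact /bcv_gamma !vec3E
  /gamma2 /gamma1 /gamma0 /contact /bcv_form ?vec3E !mxE /=; move: F0; rewrite
    /bcv_factor => F0.
- by field.
- by field.
- by field.
Qed.

End BCV.

(** * Curvature of the BCV metric *)

Section BCVCurvature.
Context {R : realType} (m l : R).
Implicit Types p u v w : 'rV[R]_3.

Local Notation F p := (bcv_factor m (p 0 0) (p 0 1)).
Local Notation h := (bcv_metric m l).
Local Notation gamma := (bcv_gamma m l).

Lemma continuous_bcv_factor p : {for p, continuous (fun q : 'rV[R]_3 => F q)}.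
Proof.
have cc i : {for p, continuous (fun q : 'rV[R]_3 => q 0 i)}.
  exact: coord_continuous.
rewrite /bcv_factor; apply: continuousD; first exact: cst_continuous.
apply: continuousM; first exact: cst_continuous.
by apply: continuousD; apply: (continuousM (cc _) (cc _)).
Qed.

Lemma near_bcv_factor_neq0 p : F p != 0 ->
  nbhs p [set q : 'rV[R]_3 | F q != 0].
Proof.
by move=> F0; exact: (cvgr_neq0 _ (@continuous_bcv_factor p) F0).
Qed.

Let dF p w := 2 * m * (p 0 0 * w 0 0 + p 0 1 * w 0 1).
(** The numerators in [gamma0] and [gamma1] are linear in the base point [(a, b)], so their
    derivatives are the same forms evaluated at the direction. *)
Let q0 u v a b := - (a * u 0 0 * v 0 0) - b * u 0 1 * v 0 0
  - b * u 0 0 * v 0 1 + a * u 0 1 * v 0 1 : R.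
Let q1 u v a b := b * u 0 0 * v 0 0 - a * u 0 0 * v 0 1
  - a * u 0 1 * v 0 0 - b * u 0 1 * v 0 1 : R.

Definition dgamma0 p w u v :=
  2 * m / F p * (q0 u v (w 0 0) (w 0 1)
                 - q0 u v (p 0 0) (p 0 1) * dF p w / F p)
  + l / 2 * (u 0 1 * dcontact m l p w v + v 0 1 * dcontact m l p w u).

Definition dgamma1 p w u v :=
  2 * m / F p * (q1 u v (w 0 0) (w 0 1)
                 - q1 u v (p 0 0) (p 0 1) * dF p w / F p)
  - l / 2 * (u 0 0 * dcontact m l p w v + v 0 0 * dcontact m l p w u).

Definition dgamma2 p w u v :=
  let x := p 0 0 in let y := p 0 1 in
  let x' := w 0 0 in let y' := w 0 1 in
  l * m / (2 * F p ^+ 2) *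
    (- (2 * (x' * y + x * y') * u 0 0 * v 0 0)
     + (2 * x * x' - 2 * y * y') * (u 0 0 * v 0 1 + u 0 1 * v 0 0)
     + 2 * (x' * y + x * y') * u 0 1 * v 0 1)
  - dF p w * (l * m / F p ^+ 3 *
    (- (2 * x * y * u 0 0 * v 0 0)
     + (x ^+ 2 - y ^+ 2) * (u 0 0 * v 0 1 + u 0 1 * v 0 0)
     + 2 * x * y * u 0 1 * v 0 1))
  - l / 2 * (y' * gamma0 m l p u v + y * dgamma0 p w u v
             - x' * gamma1 m l p u v - x * dgamma1 p w u v) / F p
  + l / 2 * (y * gamma0 m l p u v - x * gamma1 m l p u v) * dF p w / F p ^+ 2.

Definition dbcv_gamma p w u v :=
  vec3 (dgamma0 p w u v) (dgamma1 p w u v) (dgamma2 p w u v).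

Lemma is_derive_bcv_gamma p w u v : F p != 0 ->
  is_derive p w (fun q => gamma q u v) (dbcv_gamma p w u v).
Proof.
move=> F0; have dFw := is_derive_bcv_factor m p w.
have dcu := is_derive_contact l w u F0.
have dcv := is_derive_contact l w v F0.
have F20 : 2 * F p ^+ 2 != 0 by rewrite mulf_neq0 ?pnatr_eq0 // expf_neq0.
have d0 : is_derive p w (fun q => gamma0 m l q u v) (dgamma0 p w u v).
  by rewrite /gamma0; isderive_eq; rewrite /dgamma0 /q0 /dF; field.
have d1 : is_derive p w (fun q => gamma1 m l q u v) (dgamma1 p w u v).
  by rewrite /gamma1; isderive_eq; rewrite /dgamma1 /q1 /dF; field.
have d2 : is_derive p w (fun q => gamma2 m l q u v) (dgamma2 p w u v).
  by rewrite /gamma2; isderive_eq; rewrite /dgamma2 /dF; field.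
by rewrite /bcv_gamma /dbcv_gamma; isderive.
Qed.

(** With [t = l / 2], horizontal planes have sectional curvature [4m - 3t^2] and planes containing
    the fibre direction have [t^2]. The first term is the constant-curvature tensor of the former
    value; the coefficient of the correction is the difference of the two. *)
Lemma curvature_at_bcv p u v w : F p != 0 ->
  curvature_at h p u v w =
  (4 * m - 3 * (l / 2) ^+ 2) *: (inner h p v w *: u - inner h p u w *: v)
  - (4 * (m - (l / 2) ^+ 2)) *:
    (contact m l p w *: (contact m l p v *: u - contact m l p u *: v)
     + (inner h p v w * contact m l p u - inner h p u w * contact m l p v)
       *: vec3 0 0 1).
Proof.
move=> F0.
have nablaE a b : \near p, gamma p a b = nabla h (fun=> a) (fun=> b) p.
  near=> q; rewrite /nabla /nabla_along.
  rewrite (derive_val (is_derive := is_derive_cst _ _ _)) derive_id add0r.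
  by rewrite christoffel_form_bcv //; near: q; exact: near_bcv_factor_neq0.
have D a b c : nabla h (fun=> a) (nabla h (fun=> b) (fun=> c)) p
    = dbcv_gamma p a b c + gamma p a (gamma p b c).
  rewrite {1}/nabla /nabla_along derive_id.
  rewrite -(near_eq_derive a (nablaE b c)) -(nbhs_singleton (nablaE b c)).
  rewrite christoffel_form_bcv //; congr (_ + _).
  by apply: derive_val; exact: is_derive_bcv_gamma.
rewrite /curvature_at /curvature !D.
have -> : nabla h (lie_bracket (fun=> u) (fun=> v)) (fun=> w) p = 0.
  rewrite /nabla /nabla_along derive_id /lie_bracket.
  rewrite !(derive_val (is_derive := is_derive_cst _ _ _)) subrr add0r.
  rewrite christoffel_form_bcv // /bcv_gamma /gamma2 /gamma1 /gamma0 /contact.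
  by apply: row3P; rewrite !mxE /=; ring.
rewrite subr0 !inner_bcv.
have add3 (a b : 'rV[R]_3) i : (a + b) 0 i = a 0 i + b 0 i by rewrite mxE.
have opp3 (a : 'rV[R]_3) i : (- a) 0 i = - a 0 i by rewrite mxE.
have scale3 c (a : 'rV[R]_3) i : (c *: a) 0 i = c * a 0 i by rewrite mxE.
apply: row3P; rewrite !(add3, opp3, scale3) /dbcv_gamma /bcv_gamma !vec3E.
all: rewrite /dgamma2 /dgamma0 /dgamma1 /gamma2 /gamma0 /gamma1 /dcontact
  /contact ?vec3E.
all: rewrite /q0 /q1 /dF.
all: move: F0; rewrite /bcv_factor => F0.
- by field.
- by field.
- by field.
Unshelve. all: by end_near. Qed.

End BCVCurvature.

(** * Tension and bitension fields of a Hopf cylinder *)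

Section Cylinder.
Context {R : realType} (m l : R) (I : set R).
(** The coordinates of the curve and their derivatives, numbered by order. The curvature involves
    two derivatives and the bitension field differentiates it twice more. *)
Variables x0 y0 x1 y1 x2 y2 x3 y3 x4 y4 : R -> R.
Hypothesis openI : open I.
Hypothesis dx0 : forall s, I s -> is_derive s 1 x0 (x1 s).
Hypothesis dy0 : forall s, I s -> is_derive s 1 y0 (y1 s).
Hypothesis dx1 : forall s, I s -> is_derive s 1 x1 (x2 s).
Hypothesis dy1 : forall s, I s -> is_derive s 1 y1 (y2 s).
Hypothesis dx2 : forall s, I s -> is_derive s 1 x2 (x3 s).
Hypothesis dy2 : forall s, I s -> is_derive s 1 y2 (y3 s).
Hypothesis dx3 : forall s, I s -> is_derive s 1 x3 (x4 s).
Hypothesis dy3 : forall s, I s -> is_derive s 1 y3 (y4 s).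
Local Notation F s := (bcv_factor m (x0 s) (y0 s)).
Hypothesis F_gt0 : forall s, I s -> 0 < F s.
Hypothesis unit_speed : forall s, I s -> (x1 s ^+ 2 + y1 s ^+ 2) / F s ^+ 2 = 1.
Local Notation h := (bcv_metric m l).

(** The vertical component of the coordinate field [d/ds] of the cylinder, whose horizontal part is
    [X]. *)
Definition slope s := l / 2 * (y0 s * x1 s - x0 s * y1 s) / F s.

Definition slope' s := l / 2 * (y0 s * x2 s - x0 s * y2 s) / F s
  - slope s * (2 * m * (x0 s * x1 s + y0 s * y1 s)) / F s.

(** The signed geodesic curvature of the base curve. For the flat metric divided by [F^2] it is [F]
    times the Euclidean curvature plus the derivative of [F] along the Euclidean unit normal; the
    Euclidean speed is [F], whence the exponents. *)
Definition curv s := (x1 s * y2 s - y1 s * x2 s) / F s ^+ 2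
  + 2 * m * (x1 s * y0 s - y1 s * x0 s) / F s.

Definition curv' s := (x1 s * y3 s - y1 s * x3 s) / F s ^+ 2
  - 2 * (x1 s * y2 s - y1 s * x2 s)
      * (2 * m * (x0 s * x1 s + y0 s * y1 s)) / F s ^+ 3
  + 2 * m * (x2 s * y0 s - y2 s * x0 s) / F s
  - 2 * m * (x1 s * y0 s - y1 s * x0 s)
      * (2 * m * (x0 s * x1 s + y0 s * y1 s)) / F s ^+ 2.

(* [a X + b xi + c V], where [X] and [xi] are the horizontal lifts of the unit
   tangent [(x1, y1)] and of the unit normal [(- y1, x1)], and [V = d/dz]. *)
Definition frame s a b c : 'rV[R]_3 :=
  vec3 (a * x1 s - b * y1 s) (a * y1 s + b * x1 s)
    (c - l / 2 * (y0 s * (a * x1 s - b * y1 s) - x0 s * (a * y1 s + b * x1 s))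
         / F s).

Lemma F_neq0 s : I s -> F s != 0.
Proof. by move=> Is; rewrite gt_eqF ?F_gt0. Qed.

Lemma is_derive_F s : I s ->
  is_derive s 1 (fun s => F s) (2 * m * (x0 s * x1 s + y0 s * y1 s)).
Proof.
move=> Is; have dx := dx0 Is; have dy := dy0 Is.
by rewrite /bcv_factor; isderive_eq; ring.
Qed.

Lemma is_derive_slope s : I s -> is_derive s 1 slope (slope' s).
Proof.
move=> Is; have F0 := F_neq0 Is; have dF := is_derive_F Is.
have dx := dx0 Is; have dy := dy0 Is; have ddx := dx1 Is; have ddy := dy1 Is.
by rewrite /slope; isderive_eq; rewrite /slope' /slope; field.
Qed.

Lemma is_derive_curv s : I s -> is_derive s 1 curv (curv' s).
Proof.
move=> Is; have F0 := F_neq0 Is; have dF := is_derive_F Is.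
have dx := dx0 Is; have dy := dy0 Is; have ddx := dx1 Is; have ddy := dy1 Is.
have d3x := dx2 Is; have d3y := dy2 Is.
have F20 : F s ^+ 2 != 0 by rewrite expf_neq0.
by rewrite /curv; isderive_eq; rewrite /curv'; field.
Qed.

Lemma derivable_curv' s : I s -> derivable curv' s 1.
Proof.
move=> Is; have F0 := F_neq0 Is; have dF := is_derive_F Is.
have dx := dx0 Is; have dy := dy0 Is; have ddx := dx1 Is; have ddy := dy1 Is.
have d3x := dx2 Is; have d3y := dy2 Is; have d4x := dx3 Is; have d4y := dy3 Is.
have F20 : F s ^+ 2 != 0 by rewrite expf_neq0.
have F30 : F s ^+ 3 != 0 by rewrite expf_neq0.
by rewrite /curv'; notypeclasses refine (@ex_derive _ _ _ _ _ _ _ _); isderive.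
Qed.

Lemma speed2 s : I s -> x1 s ^+ 2 + y1 s ^+ 2 = F s ^+ 2.
Proof.
move=> Is; rewrite -[RHS]mul1r -(unit_speed Is) divfK //.
by rewrite expf_neq0 // F_neq0.
Qed.

Lemma near_I (s : R) : I s -> \forall t \near s, I t.
Proof. by move=> Is; apply: open_nbhs_nbhs. Qed.

Lemma speed_deriv s : I s -> x1 s * x2 s + y1 s * y2 s
  = F s * (2 * m * (x0 s * x1 s + y0 s * y1 s)).
Proof.
move=> Is; have dF := is_derive_F Is.
have ddx := dx1 Is; have ddy := dy1 Is.
have d1 : is_derive s 1 (fun s => F s ^+ 2)
    (2 * F s * (2 * m * (x0 s * x1 s + y0 s * y1 s))).
  by isderive_eq; ring.
have d2 : is_derive s 1 (fun s => F s ^+ 2)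
    (2 * x1 s * x2 s + 2 * y1 s * y2 s).
  apply: (@near_eq_is_derive _ _ _ (fun s => x1 s ^+ 2 + y1 s ^+ 2)).
    by near=> t; apply: speed2; near: t; exact: near_I.
  by isderive_eq; ring.
have := @derive_val _ _ _ _ _ _ _ d1; rewrite (derive_val (is_derive := d2)).
by move=> E; apply: (@mulfI _ 2); rewrite ?pnatr_eq0 //; move: E; lra.
Unshelve. all: by end_near. Qed.

(** The tangential part of the acceleration comes from differentiating the unit-speed relation, the
    normal part from the definition of [curv]. Eliminating [x2] and [y2] in this way turns the
    structure equations of the frame into rational identities. *)
Lemma curve_accel s : I s ->
  x2 s = (2 * m * (x0 s * x1 s + y0 s * y1 s)) * x1 s / F s - curv s * y1 s
         + 2 * m * y1 s * (x1 s * y0 s - y1 s * x0 s) / F s /\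
  y2 s = (2 * m * (x0 s * x1 s + y0 s * y1 s)) * y1 s / F s + curv s * x1 s
         - 2 * m * x1 s * (x1 s * y0 s - y1 s * x0 s) / F s.
Proof.
move=> Is; have F0 := F_neq0 Is; have F20 : F s ^+ 2 != 0 by rewrite expf_neq0.
have sp := speed2 Is; have sd := speed_deriv Is.
have E : x1 s * y2 s - y1 s * x2 s =
    F s ^+ 2 * curv s - 2 * m * (x1 s * y0 s - y1 s * x0 s) * F s.
  by rewrite /curv; field.
split; apply: (mulfI F20).
  have -> : F s ^+ 2 * x2 s = x1 s * (x1 s * x2 s + y1 s * y2 s)
      - y1 s * (x1 s * y2 s - y1 s * x2 s) by rewrite -sp; ring.
  by rewrite sd E; field.
have -> : F s ^+ 2 * y2 s = y1 s * (x1 s * x2 s + y1 s * y2 s)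
    + x1 s * (x1 s * y2 s - y1 s * x2 s) by rewrite -sp; ring.
by rewrite sd E; field.
Qed.

Lemma frameD s a b c a' b' c' :
  frame s a b c + frame s a' b' c' = frame s (a + a') (b + b') (c + c').
Proof. by apply: row3P; rewrite [LHS]mxE /frame !vec3E; ring. Qed.

Lemma frameZ s r a b c :
  r *: frame s a b c = frame s (r * a) (r * b) (r * c).
Proof. by apply: row3P; rewrite [LHS]mxE /frame !vec3E; ring. Qed.

Lemma frameN s a b c : - frame s a b c = frame s (- a) (- b) (- c).
Proof. by apply: row3P; rewrite [LHS]mxE /frame !vec3E; ring. Qed.

Lemma frameV s : vec3 0 0 1 = frame s 0 0 1.
Proof. by apply: row3P; rewrite /frame !vec3E; ring. Qed.

Lemma frame_eq0 s a b c : I s -> frame s a b c = 0 -> [/\ a = 0, b = 0 & c = 0].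
Proof.
move=> Is /rowP E; have sp := speed2 Is; have F20 := expf_neq0 2 (F_neq0 Is).
have := E 0; have := E 1; have := E 2; rewrite /frame !vec3E !mxE => E2 E1 E0.
have a0 : a = 0.
  apply: (mulfI F20); rewrite -sp mulr0.
  transitivity (x1 s * (a * x1 s - b * y1 s) + y1 s * (a * y1 s + b * x1 s)).
    by ring.
  by rewrite E0 E1 !mulr0 addr0.
have b0 : b = 0.
  apply: (mulfI F20); rewrite -sp mulr0.
  transitivity (x1 s * (a * y1 s + b * x1 s) - y1 s * (a * x1 s - b * y1 s)).
    by ring.
  by rewrite E0 E1 !mulr0 subr0.
by split=> //; move: E2; rewrite E0 E1 !mulr0 subr0 mulr0 mul0r subr0.
Qed.

Lemma contact_frame s (p : 'rV[R]_3) a b c : p 0 0 = x0 s -> p 0 1 = y0 s ->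
  contact m l p (frame s a b c) = c.
Proof. by move=> px py; rewrite /contact /frame !vec3E px py; ring. Qed.

Lemma inner_frame s (p : 'rV[R]_3) a b c a' b' c' : I s -> p 0 0 = x0 s -> p 0 1
  = y0 s ->
  inner h p (frame s a b c) (frame s a' b' c') = a * a' + b * b' + c * c'.
Proof.
move=> Is px py; rewrite inner_bcv !(contact_frame _ _ _ px py) px py.
have -> : a * a' + b * b' = (a * a' + b * b')
    * ((x1 s ^+ 2 + y1 s ^+ 2) / F s ^+ 2) by rewrite unit_speed // mulr1.
by rewrite /frame !vec3E mulrA; congr (_ / _ + _); ring.
Qed.

Lemma is_derive_frame (V : normedModType R) (sg al be ga : V -> R) q v
    dsg dal dbe dga : I (sg q) ->
  is_derive q v sg dsg -> is_derive q v al dal -> is_derive q v be dbe ->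
  is_derive q v ga dga ->
  is_derive q v (fun p => frame (sg p) (al p) (be p) (ga p))
   (let s := sg q in
    let c0 := al q * x1 s - be q * y1 s in
    let c1 := al q * y1 s + be q * x1 s in
    let d0 := dal * x1 s + al q * x2 s * dsg
              - (dbe * y1 s + be q * y2 s * dsg) in
    let d1 := dal * y1 s + al q * y2 s * dsg
              + (dbe * x1 s + be q * x2 s * dsg) in
    let dF := 2 * m * (x0 s * x1 s + y0 s * y1 s) * dsg in
    vec3 d0 d1
      (dga - l / 2 * (y1 s * dsg * c0 + y0 s * d0 - x1 s * dsg * c1 - x0 s * d1)
               / F s
       + l / 2 * (y0 s * c0 - x0 s * c1) * dF / F s ^+ 2)).
Proof.
move=> Is dsgq dalq dbeq dgaq; have F0 := F_neq0 Is.
have dx := is_derive_comp_fct (dx0 Is) dsgq.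
have dy := is_derive_comp_fct (dy0 Is) dsgq.
have dxx := is_derive_comp_fct (dx1 Is) dsgq.
have dyy := is_derive_comp_fct (dy1 Is) dsgq.
have dF := is_derive_comp_fct (is_derive_F Is) dsgq.
by rewrite /frame; isderive_eq; congr vec3; field.
Qed.

(* The coefficients are the structure equations of the frame: [D_X X = k xi],
   [D_X xi = - k X + tau V], [D_X V = D_V X = - tau xi], [D_V xi = tau X] and
   [D_V V = 0], where [tau = l / 2]. *)
Lemma nabla_along_frame (V : normedModType R) (Phi : V -> 'rV[R]_3)
    (X : V -> V) (W : V -> 'rV[R]_3) (sg al be ga : V -> R) q
    v dsg w dal dbe dga :
  I (sg q) -> Phi q 0 0 = x0 (sg q) -> Phi q 0 1 = y0 (sg q) -> X q = v ->
  is_derive q v Phi (frame (sg q) dsg 0 w) ->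
  is_derive q v sg dsg -> is_derive q v al dal ->
  is_derive q v be dbe -> is_derive q v ga dga ->
  (\forall p \near q, frame (sg p) (al p) (be p) (ga p) = W p) ->
  nabla_along h Phi X W q =
  let k := curv (sg q) in
  frame (sg q) (dal + be q * (w * (l / 2) - dsg * k))
    (dbe + al q * (dsg * k - w * (l / 2)) - ga q * dsg * (l / 2))
    (dga + be q * dsg * (l / 2)).
Proof.
move=> Is Px Py Xq dPhi dsgq dalq dbeq dgaq WE; have F0 := F_neq0 Is.
have dfr := is_derive_frame Is dsgq dalq dbeq dgaq.
rewrite /nabla_along Xq -(near_eq_derive _ WE) (derive_val (is_derive := dfr)).
rewrite (derive_val (is_derive := dPhi)) -(nbhs_singleton WE).
rewrite christoffel_form_bcv ?Px ?Py //.
(* The squared speed produced by the vertical component of the connection is inserted by hand; what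
   remains holds identically in the coordinates and their first derivatives. *)
have -> : be q * dsg * (l / 2) = be q * dsg * (l / 2)
    * ((x1 (sg q) ^+ 2 + y1 (sg q) ^+ 2) / F (sg q) ^+ 2).
  by rewrite unit_speed // mulr1.
have [x2E y2E] := curve_accel Is.
apply: row3P; rewrite mxE /bcv_gamma /frame !vec3E /gamma2 /gamma1 /gamma0
  /contact !vec3E Px Py
 x2E y2E; move: (curv _) => k; move: F0; rewrite /bcv_factor => F0.
- by field.
- by field.
- by field.
Qed.


(** * The cylinder as a map and its conformally changed metric *)

Local Notation U := (hopf_domain I).
Local Notation e0 := (delta_mx 0 0 : 'rV[R]_2).
Local Notation e1 := (delta_mx 0 1 : 'rV[R]_2).

Lemma delta2E : (e0 0 0 = 1) * (e0 0 1 = 0) * (e1 0 0 = 0) * (e1 0 1 = 1).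
Proof. by rewrite !mxE. Qed.

Lemma near_hopf_domain (q : 'rV[R]_2) : U q -> nbhs q U.
Proof.
move=> Uq; apply: (@coord_continuous _ _ _ 0 0 q I).
exact: open_nbhs_nbhs.
Qed.

Definition cyl (q : 'rV[R]_2) : 'rV[R]_3 :=
  vec3 (x0 (q 0 0)) (y0 (q 0 0)) (q 0 1).

Lemma cyl_x q : cyl q 0 0 = x0 (q 0 0). Proof. by rewrite /cyl vec3E. Qed.

Lemma cyl_y q : cyl q 0 1 = y0 (q 0 0). Proof. by rewrite /cyl vec3E. Qed.

Lemma is_derive_cyl (q v : 'rV[R]_2) : U q ->
  is_derive q v cyl (frame (q 0 0) (v 0 0) 0 (slope (q 0 0) * v 0 0 + v 0 1)).
Proof.
move=> Uq; have ds := is_derive_coord q v 0.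
have dx := is_derive_comp_fct (dx0 Uq) ds.
have dy := is_derive_comp_fct (dy0 Uq) ds.
by rewrite /cyl; isderive_eq; rewrite /frame /slope; congr vec3; ring.
Qed.

Lemma smooth_on_derive (V W : normedModType R) (A : set V) (G : V -> W) v :
  smooth_on A G -> smooth_on A ('D_v G).
Proof. by move=> sG k; have [_ /(_ v)[]] := sG k.+1. Qed.

Lemma smooth_on_is_derive (V W : normedModType R) (A : set V) (G : V -> W) v p :
  smooth_on A G -> A p -> is_derive p v G ('D_v G p).
Proof.
by move=> sG Ap; have [_ /(_ v)[dG _]] := sG 1%N; apply/derivableP/dG.
Qed.

(** Continuity of one partial derivative near [q] makes the directional derivatives additive, hence
    expressible by the two partial derivatives. *)
Lemma smooth_on_is_derive2 (G : 'rV[R]_2 -> R) q v : smooth_on U G -> U q ->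
  is_derive q v G (v 0 0 * 'D_e0 G q + v 0 1 * 'D_e1 G q).
Proof.
move=> sG Uq.
have vE : v = v 0 0 *: e0 + v 0 1 *: e1.
  by apply: row2P; rewrite !mxE /= ?mulr1 ?mulr0 ?addr0 ?add0r.
have d0 := is_derive_scale (v 0 0) (smooth_on_is_derive e0 sG Uq).
have d1 := is_derive_scale (v 0 1) (smooth_on_is_derive e1 sG Uq).
rewrite [X in is_derive _ X]vE -(derive_val (is_derive := d1)).
apply: is_derive_directionD => //.
  near=> p; have Up : U p by near: p; exact: near_hopf_domain.
  by case: (smooth_on_is_derive (v 0 1 *: e1) sG Up).
by have [cG _] := smooth_on_derive (v 0 1 *: e1) sG 0; exact: cG.
Unshelve. all: by end_near. Qed.

(** Suffixes begin with the last derivative taken: [fzs] is the [z]-derivative of [fs], [fsz] the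
    [s]-derivative of [fz]. *)
Variables f fs fz fss fsz fzs fzz : 'rV[R]_2 -> R.
Variable curv'' : R -> R.
Hypothesis f_gt0 : forall q, U q -> 0 < f q.
Hypothesis df : forall q v, U q -> is_derive q v f (v 0 0 * fs q + v 0 1 * fz
  q).
Hypothesis dfs : forall q v, U q ->
  is_derive q v fs (v 0 0 * fss q + v 0 1 * fzs q).
Hypothesis dfz : forall q v, U q ->
  is_derive q v fz (v 0 0 * fsz q + v 0 1 * fzz q).
Hypothesis dcurv' : forall s, I s -> is_derive s 1 curv' (curv'' s).
Local Notation g := (conformal_metric f (pullback_metric h cyl)).

(** The vertical component of the [i]-th coordinate field of the cylinder. *)
Let wt (q : 'rV[R]_2) i := slope (q 0 0) * (delta_mx 0 i : 'rV[R]_2) 0 0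
  + (delta_mx 0 i : 'rV[R]_2) 0 1.

Let G (q : 'rV[R]_2) i j :=
  (delta_mx 0 i : 'rV[R]_2) 0 0 * (delta_mx 0 j : 'rV[R]_2) 0 0
  + wt q i * wt q j.

Lemma cyl_metricE q i j : U q -> g q i j = (f q)^-1 * G q i j.
Proof.
move=> Uq; rewrite /conformal_metric /pullback_metric mxE mxE.
rewrite !(derive_val (is_derive := is_derive_cyl _ Uq)).
rewrite (@inner_frame (q 0 0)) ?/cyl ?vec3E //.
by rewrite mulr0 addr0.
Qed.

Definition dcyl_metric (q v : 'rV[R]_2) i j :=
  - (v 0 0 * fs q + v 0 1 * fz q) / f q ^+ 2 * G q i j
  + (f q)^-1 * (slope' (q 0 0) * v 0 0)
    * ((delta_mx 0 i : 'rV[R]_2) 0 0 * wt q j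
       + wt q i * (delta_mx 0 j : 'rV[R]_2) 0 0).

Lemma is_derive_cyl_metric (q v : 'rV[R]_2) i j : U q ->
  is_derive q v (fun p => g p i j) (dcyl_metric q v i j).
Proof.
move=> Uq; have ds := is_derive_comp_fct (is_derive_slope Uq) (is_derive_coord q
  v 0).
have dfq := df v Uq.
have f0 : f q != 0 by rewrite gt_eqF ?f_gt0.
apply: (@near_eq_is_derive _ _ _ (fun p => (f p)^-1 * G p i j)).
  near=> p; rewrite cyl_metricE //; near: p; exact: near_hopf_domain.
by rewrite /G /wt; isderive_eq; rewrite /dcyl_metric /G /wt; field.
Unshelve. all: by end_near. Qed.

(** In the coordinates [(s, z)] the frame [X], [V] is [(1, - a)], [(0, 1)]; the dual metric is [f]
    times the sum of its squares. *)
Definition cyl_inv (q : 'rV[R]_2) (i j : 'I_2) : R :=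
  let a := slope (q 0 0) in
  f q * (vec2 1 (- a) 0 i * vec2 1 (- a) 0 j + vec2 0 1 0 i * vec2 0 1 0 j).

Lemma invmx_cyl_metric q i j : U q -> invmx (g q) i j = cyl_inv q i j.
Proof.
move=> Uq; have f0 : f q != 0 by rewrite gt_eqF ?f_gt0.
suff AB : g q *m (\matrix_(i, j) cyl_inv q i j) = 1%:M.
  have [Au _] := mulmx1_unit AB.
  suff -> : invmx (g q) = \matrix_(i, j) cyl_inv q i j by rewrite mxE.
  by rewrite -[RHS]mul1mx -(mulVmx Au) -mulmxA AB mulmx1.
apply/matrixP => r c; rewrite [LHS]mxE sum_ord2 !cyl_metricE //.
rewrite ![(\matrix_(_, _) _) _ _]mxE [RHS]mxE /cyl_inv /G /wt.
by case: (ord2P r) => ->; case: (ord2P c) => ->; rewrite !mxE /=; field.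
Qed.

Definition cyl_christoffel (q : 'rV[R]_2) (i j k : 'I_2) : R :=
  2^-1 * (cyl_inv q k 0 *
    (dcyl_metric q (delta_mx 0 i) j 0 + dcyl_metric q (delta_mx 0 j) i 0
     - dcyl_metric q (delta_mx 0 0) i j)
  + cyl_inv q k 1 *
    (dcyl_metric q (delta_mx 0 i) j 1 + dcyl_metric q (delta_mx 0 j) i 1
     - dcyl_metric q (delta_mx 0 1) i j)).

Lemma nabla_cyl_coord q i j : U q ->
  nabla g (coord_field i) (coord_field j) q
  = vec2 (cyl_christoffel q i j 0) (cyl_christoffel q i j 1).
Proof.
move=> Uq; rewrite /nabla /nabla_along derive_id.
rewrite (derive_val (is_derive := is_derive_cst _ _ _)) add0r.
have dg r i' j' : partial r (fun p => g p i' j') q = dcyl_metric q (delta_mx 0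
  r) i' j'.
  by apply: derive_val; exact: is_derive_cyl_metric.
have CE k : christoffel g q k i j = cyl_christoffel q i j k.
  by rewrite /christoffel sum_ord2 !dg !invmx_cyl_metric.
rewrite /coord_field; apply: row2P; rewrite vec2E mxE -CE !sum_ord2;
  move: (christoffel g q _) => C; case: (ord2P i) => ->; case: (ord2P j) => ->;
    rewrite !delta2E; ring.
Qed.

(* In dimension two, [g^ij Gamma^k_ij] scales by [f] under the conformal
   change. *)
Lemma cyl_christoffel_trace q : U q ->
  \sum_(i < 2) \sum_(j < 2) cyl_inv q i j * cyl_christoffel q i j 0 = 0 /\
  \sum_(i < 2) \sum_(j < 2) cyl_inv q i j * cyl_christoffel q i j 1
    = f q * slope' (q 0 0).
Proof.
move=> Uq; have f0 : f q != 0 by rewrite gt_eqF ?f_gt0.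
rewrite !sum_ord2 /cyl_christoffel /dcyl_metric /cyl_inv /G /wt !delta2E !vec2E.
move: f0 (slope' _) (slope _) (fs q) (fz q).
by move: (f q) => c c0 a' a c1 c2; split; field.
Qed.


Lemma sum_frame s (c A B C : 'I_2 -> 'I_2 -> R) :
  \sum_(i < 2) \sum_(j < 2) c i j *: frame s (A i j) (B i j) (C i j) =
  frame s (\sum_(i < 2) \sum_(j < 2) c i j * A i j)
          (\sum_(i < 2) \sum_(j < 2) c i j * B i j)
          (\sum_(i < 2) \sum_(j < 2) c i j * C i j).
Proof. by rewrite !sum_ord2 !frameZ !frameD. Qed.

(** Both the tension and the rough Laplacian are traces of a second derivative minus a first
    derivative along the connection of the domain; of the latter only a [z]-derivative survives the
    trace. *)
Lemma sum_christoffelB q (P : 'I_2 -> 'I_2 -> R) al be : U q ->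
  \sum_(i < 2) \sum_(j < 2) cyl_inv q i j *
    (P i j - (al * cyl_christoffel q i j 0 + be * cyl_christoffel q i j 1)) =
  \sum_(i < 2) \sum_(j < 2) cyl_inv q i j * P i j - be * (f q * slope' (q 0 0)).
Proof.
move=> Uq; have [c0 c1] := cyl_christoffel_trace Uq.
transitivity (\sum_(i < 2) \sum_(j < 2) cyl_inv q i j * P i j
  - al * (\sum_(i < 2) \sum_(j < 2) cyl_inv q i j * cyl_christoffel q i j 0)
  - be * (\sum_(i < 2) \sum_(j < 2) cyl_inv q i j * cyl_christoffel q i j 1)).
  by rewrite !sum_ord2; move: (cyl_inv q) (cyl_christoffel q) => c C; ring.
by rewrite c0 c1 mulr0 subr0.
Qed.

Lemma trace_metric_cyl q (A B C : 'I_2 -> 'I_2 -> R)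
    (T : 'I_2 -> 'I_2 -> 'rV[R]_3) : U q ->
  (forall i j, T i j = frame (q 0 0) (A i j) (B i j) (C i j)) ->
  trace_metric g q T = frame (q 0 0)
    (\sum_(i < 2) \sum_(j < 2) cyl_inv q i j * A i j)
    (\sum_(i < 2) \sum_(j < 2) cyl_inv q i j * B i j)
    (\sum_(i < 2) \sum_(j < 2) cyl_inv q i j * C i j).
Proof.
move=> Uq TE; rewrite -sum_frame; apply: eq_bigr => i _; apply: eq_bigr => j _.
by rewrite invmx_cyl_metric // TE.
Qed.

Local Notation D0 i := ((delta_mx 0 i : 'rV[R]_2) 0 0).
Local Notation D1 i := ((delta_mx 0 i : 'rV[R]_2) 0 1).

(** The trivial factors [0] and [1] are kept so that each component has the shape required by
    [sum_christoffelB]. *)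
Lemma hess_cyl q i j : U q ->
  let s := q 0 0 in let a := slope s in
  hess_map g h cyl (coord_field i) (coord_field j) q = frame s
   (0 - (1 * cyl_christoffel q i j 0 + 0 * cyl_christoffel q i j 1))
   (D0 j * (D0 i * curv s - wt q i * (l / 2)) - wt q j * D0 i * (l / 2))
   (slope' s * D0 i * D0 j
    - (a * cyl_christoffel q i j 0 + 1 * cyl_christoffel q i j 1)).
Proof.
move=> Uq s a; rewrite /hess_map.
have ds := is_derive_coord q (delta_mx 0 i) 0.
have dsl := is_derive_comp_fct (is_derive_slope Uq) ds.
have dw : is_derive q (delta_mx 0 i) (fun p => wt p j) (slope' s * D0 i * D0 j).
  by rewrite /wt; isderive_eq; rewrite /s; ring.
have dPhi := is_derive_cyl (delta_mx 0 i) Uq.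
have WE : \forall p \near q, frame ((p : 'rV[R]_2) 0 0) (D0 j) 0 (wt p j)
    = 'D_(coord_field j p) cyl p.
  near=> p; rewrite (derive_val (is_derive := is_derive_cyl _ _)) //.
  by near: p; exact: near_hopf_domain.
rewrite (nabla_along_frame Uq (cyl_x q) (cyl_y q) (erefl _) dPhi ds
  (is_derive_fct_cst _ _ _) (is_derive_fct_cst _ _ _) dw WE).
rewrite nabla_cyl_coord // (derive_val (is_derive := is_derive_cyl _ Uq))
  !vec2E.
by rewrite frameN frameD; congr frame; rewrite /a /s /wt; ring.
Unshelve. all: by end_near. Qed.

Lemma tension_cyl q : U q ->
  tension g h cyl q = frame (q 0 0) 0 (f q * curv (q 0 0)) 0.
Proof.
move=> Uq; rewrite /tension (trace_metric_cyl Uq (fun i j => hess_cyl i j Uq)).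
rewrite !(sum_christoffelB _ _ _ Uq) !sum_ord2 /cyl_inv /wt !delta2E !vec2E.
by congr frame; ring.
Qed.

Definition dtension (q v : 'rV[R]_2) :=
  (v 0 0 * fs q + v 0 1 * fz q) * curv (q 0 0)
  + f q * (curv' (q 0 0) * v 0 0).

Lemma is_derive_tension_coef (q v : 'rV[R]_2) : U q ->
  is_derive q v (fun p => f p * curv (p 0 0)) (dtension q v).
Proof.
move=> Uq; have dk := is_derive_comp_fct (is_derive_curv Uq) (is_derive_coord q
  v 0).
have dfq := df v Uq.
by isderive_eq; rewrite /dtension; ring.
Qed.

Lemma nabla_tension (X : 'rV[R]_2 -> 'rV[R]_2) (q v : 'rV[R]_2) : U q -> X q = v
  ->
  let s := q 0 0 in let u := f q * curv s in
  nabla_along h cyl X (tension g h cyl) q = frame s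
    (u * ((slope s * v 0 0 + v 0 1) * (l / 2) - v 0 0 * curv s))
    (dtension q v) (u * v 0 0 * (l / 2)).
Proof.
move=> Uq Xq s u.
have WE : \forall p \near q,
    frame ((p : 'rV[R]_2) 0 0) 0 (f p * curv (p 0 0)) 0 = tension g h cyl p.
  by near=> p; rewrite tension_cyl //; near: p; exact: near_hopf_domain.
rewrite (nabla_along_frame Uq (cyl_x q) (cyl_y q) Xq (is_derive_cyl v Uq)
  (is_derive_coord q v 0) (is_derive_fct_cst _ _ _) (is_derive_tension_coef v
    Uq)
  (is_derive_fct_cst _ _ _) WE).
by congr frame; rewrite /u /s; ring.
Unshelve. all: by end_near. Qed.

(** Here [al], [be], [ga] are the frame components of the covariant derivative of the tension field
    along the [j]-th coordinate field. *)
Lemma nabla2_tension q i j : U q ->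
  let s := q 0 0 in let k := curv s in let u := f q * k in let t := l / 2 in
  let al := u * (wt q j * t - D0 j * k) in
  let be := dtension q (delta_mx 0 j) in
  let ga := u * D0 j * t in
  let du := dtension q (delta_mx 0 i) in
  nabla2_along g h cyl (coord_field i) (coord_field j) (tension g h cyl) q =
  frame s
   (du * (wt q j * t - D0 j * k) + u * (slope' s * t - curv' s) * D0 i * D0 j
      + be * (wt q i * t - D0 i * k)
    - (u * (slope s * t - k) * cyl_christoffel q i j 0
       + u * t * cyl_christoffel q i j 1))
   ((D0 i * (D0 j * fss q + D1 j * fsz q)
     + D1 i * (D0 j * fzs q + D1 j * fzz q)) * k
     + (D0 j * fs q + D1 j * fz q) * curv' s * D0 i
     + (D0 i * fs q + D1 i * fz q) * curv' s * D0 j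
     + f q * curv'' s * D0 i * D0 j
     + al * (D0 i * k - wt q i * t) - ga * D0 i * t
    - ((fs q * k + f q * curv' s) * cyl_christoffel q i j 0
       + fz q * k * cyl_christoffel q i j 1))
   (du * D0 j * t + be * D0 i * t
    - (u * t * cyl_christoffel q i j 0 + 0 * cyl_christoffel q i j 1)).
Proof.
move=> Uq s k u t al be ga du; rewrite /nabla2_along.
have ds := is_derive_coord q (delta_mx 0 i) 0.
have dsl := is_derive_comp_fct (is_derive_slope Uq) ds.
have dk := is_derive_comp_fct (is_derive_curv Uq) ds.
have dk' := is_derive_comp_fct (dcurv' Uq) ds.
have dut := is_derive_tension_coef (delta_mx 0 i) Uq.
have dfq := df (delta_mx 0 i) Uq.
have dfsq := dfs (delta_mx 0 i) Uq.
have dfzq := dfz (delta_mx 0 i) Uq.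
have WE : \forall p \near q, frame ((p : 'rV[R]_2) 0 0)
      (f p * curv (p 0 0) * (wt p j * t - D0 j * curv (p 0 0)))
      (dtension p (delta_mx 0 j)) (f p * curv (p 0 0) * D0 j * t) =
    nabla_along h cyl (coord_field j) (tension g h cyl) p.
  near=> p; rewrite (@nabla_tension _ p (delta_mx 0 j)) //.
  by near: p; exact: near_hopf_domain.
have dal : is_derive q (delta_mx 0 i)
    (fun p => f p * curv (p 0 0) * (wt p j * t - D0 j * curv (p 0 0)))
    (du * (wt q j * t - D0 j * k) + u * (slope' s * t - curv' s) * D0 i * D0 j).
  rewrite /wt; isderive_eq; rewrite -/s -/k -/u.
  by rewrite /du /dtension /wt -/s -/k; ring.
have dbe : is_derive q (delta_mx 0 i) (fun p => dtension p (delta_mx 0 j))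
    ((D0 i * (D0 j * fss q + D1 j * fsz q)
     + D1 i * (D0 j * fzs q + D1 j * fzz q)) * k
     + (D0 j * fs q + D1 j * fz q) * curv' s * D0 i
     + (D0 i * fs q + D1 i * fz q) * curv' s * D0 j
     + f q * curv'' s * D0 i * D0 j).
  by rewrite /dtension; isderive_eq; rewrite /k /s; ring.
have dga : is_derive q (delta_mx 0 i) (fun p => f p * curv (p 0 0) * D0 j * t)
    (du * D0 j * t).
  by isderive_eq; rewrite /du /dtension -/s -/k; ring.
rewrite (nabla_along_frame Uq (cyl_x q) (cyl_y q) (erefl _)
  (is_derive_cyl (delta_mx 0 i) Uq) ds dal dbe dga WE).
rewrite (nabla_tension Uq (nabla_cyl_coord i j Uq)) !vec2E frameN frameD.
rewrite /al /be /ga /du /u /k /s /dtension !vec2E /wt.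
move: (cyl_christoffel q i j 0) (cyl_christoffel q i j 1) => c0 c1.
by congr frame; rewrite /t; ring.
Unshelve. all: by end_near. Qed.

(** The tension field is horizontal and normal to the cylinder, so every term of the curvature
    vanishes except the multiples of that field itself. *)
Lemma curvature_cyl q i j : U q ->
  curvature_at h (cyl q) ('D_(delta_mx 0 i) cyl q) (tension g h cyl q)
    ('D_(delta_mx 0 j) cyl q) =
  frame (q 0 0) 0
    (f q * curv (q 0 0)
     * (4 * (m - (l / 2) ^+ 2) * (wt q i * wt q j)
        - (4 * m - 3 * (l / 2) ^+ 2) * (D0 i * D0 j + wt q i * wt q j))) 0.
Proof.
move=> Uq; rewrite !(derive_val (is_derive := is_derive_cyl _ Uq)) tension_cyl
  //.
have cx := cyl_x q; have cy := cyl_y q.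
rewrite curvature_at_bcv ?cx ?cy ?F_neq0 // !(inner_frame _ _ _ _ _ _ Uq cx cy).
rewrite !(contact_frame _ _ _ cx cy) (frameV (q 0 0)).
rewrite !(frameZ, frameN, frameD).
rewrite /wt; congr frame; ring.
Qed.

(** Since [X = d/ds - a d/dz], the expression [u0 - a * u1] is [X u], and the term in [slope'] of
    the normal component arises in [X X u] from differentiating [a]. *)
Lemma bitension_cyl q : U q ->
  let s := q 0 0 in let a := slope s in let t := l / 2 in
  let k := curv s in let k' := curv' s in let u := f q * k in
  let u0 := fs q * k + f q * k' in let u1 := fz q * k in
  bitension g h cyl q = f q *: frame s
    (2 * t * u1 - 2 * k * (u0 - a * u1) - u * k')
    (fss q * k + 2 * fs q * k' + f q * curv'' s
     - a * ((fsz q + fzs q) * k + 2 * fz q * k')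
     + (1 + a ^+ 2) * (fzz q * k) - slope' s * u1
     - u * (k ^+ 2 + 4 * t ^+ 2 - 4 * m))
    (2 * t * (u0 - a * u1)).
Proof.
move=> Uq s a t k k' u u0 u1; rewrite /bitension.
rewrite (trace_metric_cyl Uq (fun i j => nabla2_tension i j Uq)).
rewrite (trace_metric_cyl Uq (fun i j => curvature_cyl i j Uq)).
rewrite !(sum_christoffelB _ _ _ Uq) !sum_ord2 /dtension /cyl_inv /wt !delta2E
  !vec2E.
rewrite frameN frameD frameZ.
rewrite /u0 /u1 /u /k' /k /a /t /s.
by congr frame; field.
Qed.

End Cylinder.

(** * Linear differential equations on an interval *)

Section LinearODE.
Context {R : realType} (I : set R).
Hypothesis interval_I : is_interval I.

Lemma is_derive0_interval_cst (g : R -> R) :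
  (forall s, I s -> is_derive s 1 g 0) -> forall s t, I s -> I t -> g s = g t.
Proof.
move=> dg s t; wlog st : s t / s <= t => [H Is It|Is It].
  by case: (leP s t) => [/H|/ltW /H H']; [exact|rewrite H'].
have Iz z : z \in `[s, t] -> I z.
  by rewrite in_itv /= => ?; exact: (interval_I Is It).
have [z zst||z _] := @MVT_segment R g (fun=> 0) s t st.
- by apply: dg; apply: Iz; apply: subset_itv_oo_cc zst.
- by apply: derivable_within_continuous => z /Iz/dg[].
by rewrite mul0r => /eqP; rewrite subr_eq0 => /eqP.
Qed.

Lemma is_derive_expR_scale (w s : R) :
  is_derive s 1 (fun s => expR (w * s)) (w * expR (w * s)).
Proof.
rewrite mulrC; apply: is_derive_comp_fct.
have := @is_derive_fctM R _ (fun=> w) id s 1 0 1 _ _.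
by rewrite mulr1 mulr0 addr0; apply.
Qed.

Lemma is_derive_cos_scale (w s : R) :
  is_derive s 1 (fun s => cos (w * s)) (- (w * sin (w * s))).
Proof.
rewrite mulrC -mulNr; apply: is_derive_comp_fct.
have := @is_derive_fctM R _ (fun=> w) id s 1 0 1 _ _.
by rewrite mulr1 mulr0 addr0; apply.
Qed.

Lemma is_derive_sin_scale (w s : R) :
  is_derive s 1 (fun s => sin (w * s)) (w * cos (w * s)).
Proof.
rewrite mulrC; apply: is_derive_comp_fct.
have := @is_derive_fctM R _ (fun=> w) id s 1 0 1 _ _.
by rewrite mulr1 mulr0 addr0; apply.
Qed.

Variables (y dy : R -> R) (s0 : R).
Hypothesis Is0 : I s0.
Hypothesis dyE : forall s, I s -> is_derive s 1 y (dy s).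

(** Factoring the operator as [(D - w) (D + w)] yields the two first integrals [p] and [q], from
    which [y] and [dy] are recovered linearly. *)
Lemma ode_hyperbolic (w : R) : w != 0 ->
  (forall s, I s -> is_derive s 1 dy (w ^+ 2 * y s)) ->
  exists a b, forall s, I s ->
    y s = a * expR (w * s) + b * expR (- (w * s)) /\
    dy s = w * (a * expR (w * s) - b * expR (- (w * s))).
Proof.
move=> w0 ddy.
pose p s := (dy s + w * y s) * expR (- w * s).
pose q s := (dy s - w * y s) * expR (w * s).
have pc s : I s -> p s = p s0.
  move=> Is; apply: is_derive0_interval_cst => // t It.
  have h1 := dyE It; have h2 := ddy _ It; have h3 := is_derive_expR_scale (- w)
    t.
  by rewrite /p; isderive_eq; ring.
have qc s : I s -> q s = q s0.
  move=> Is; apply: is_derive0_interval_cst => // t It.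
  have h1 := dyE It; have h2 := ddy _ It; have h3 := is_derive_expR_scale w t.
  by rewrite /q; isderive_eq; ring.
exists (p s0 / (2 * w)), (- q s0 / (2 * w)) => s Is.
rewrite -(pc s Is) -(qc s Is) /p /q mulNr.
have e1 : expR (- (w * s)) * expR (w * s) = 1 by rewrite -expRD addNr expR0.
split.
  transitivity (y s * (expR (- (w * s)) * expR (w * s))); last by field.
  by rewrite e1 mulr1.
transitivity (dy s * (expR (- (w * s)) * expR (w * s))); last by field.
by rewrite e1 mulr1.
Qed.

(** The vector [(y, dy / w)], rotated by the angle [w s], is constant. *)
Lemma ode_trigonometric (w : R) : w != 0 ->
  (forall s, I s -> is_derive s 1 dy (- (w ^+ 2 * y s))) ->
  exists a b, forall s, I s ->
    y s = a * cos (w * s) + b * sin (w * s) /\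
    dy s = w * (b * cos (w * s) - a * sin (w * s)).
Proof.
move=> w0 ddy.
pose p s := y s * cos (w * s) - dy s / w * sin (w * s).
pose q s := y s * sin (w * s) + dy s / w * cos (w * s).
have pc s : I s -> p s = p s0.
  move=> Is; apply: is_derive0_interval_cst => // t It.
  have h1 := dyE It; have h2 := ddy _ It.
  have h3 := is_derive_cos_scale w t; have h4 := is_derive_sin_scale w t.
  by rewrite /p; isderive_eq; field.
have qc s : I s -> q s = q s0.
  move=> Is; apply: is_derive0_interval_cst => // t It.
  have h1 := dyE It; have h2 := ddy _ It.
  have h3 := is_derive_cos_scale w t; have h4 := is_derive_sin_scale w t.
  by rewrite /q; isderive_eq; field.
exists (p s0), (q s0) => s Is; rewrite -(pc s Is) -(qc s Is) /p /q.
have e1 := cos2Dsin2 (w * s).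
split.
  by transitivity (y s * (cos (w * s) ^+ 2 + sin (w * s) ^+ 2));
    [rewrite e1 mulr1|ring].
by transitivity (dy s * (cos (w * s) ^+ 2 + sin (w * s) ^+ 2));
  [rewrite e1 mulr1|field].
Qed.

Lemma ode_affine : (forall s, I s -> is_derive s 1 dy 0) ->
  exists a b, forall s, I s -> y s = a * s + b /\ dy s = a.
Proof.
move=> ddy; exists (dy s0), (y s0 - dy s0 * s0) => s Is.
have dc t : I t -> dy t = dy s0 by move=> It; exact: is_derive0_interval_cst.
split; last exact: dc.
suff : y s - dy s0 * s = y s0 - dy s0 * s0 by lra.
apply: (@is_derive0_interval_cst (fun s => y s - dy s0 * s)) => // t It.
have h1 := dyE It; have h2 := is_derive_id t (1 : R).
by isderive_eq; rewrite dc //; ring.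
Qed.

End LinearODE.

(** * Closed forms for [psi] and for the curvature *)

Lemma psi_sol_ode (R : realType) (K : R) (y dy : R -> R) :
  (forall z : R, is_derive z 1 y (dy z)) ->
  (forall z : R, is_derive z 1 dy (K * y z)) ->
  exists a b, forall z, y z = psi_sol K a b z.
Proof.
move=> dyE ddy; have iT : is_interval (@setT R) by [].
rewrite /psi_sol; case: ltgtP => K0.
- have w2 : Num.sqrt (- K) ^+ 2 = - K by rewrite sqr_sqrtr // oppr_ge0 ltW.
  have w0 : Num.sqrt (- K) != 0 by rewrite gt_eqF // sqrtr_gt0 oppr_gt0.
  have [|a [b ab]] := @ode_trigonometric R _ iT y dy 0 I (fun z _ => dyE z) _
    w0.
    by move=> z _; rewrite w2 mulNr opprK.
  (* [psi_sol] takes the coefficient of the sine first. *)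
  by exists b, a => z; have [-> _] := ab z I; rewrite addrC.
- have w2 : Num.sqrt K ^+ 2 = K by rewrite sqr_sqrtr // ltW.
  have w0 : Num.sqrt K != 0 by rewrite gt_eqF // sqrtr_gt0.
  have [|a [b ab]] := @ode_hyperbolic R _ iT y dy 0 I (fun z _ => dyE z) _ w0.
    by move=> z _; rewrite w2.
  by exists a, b => z; have [] := ab z I.
- have [|a [b ab]] := @ode_affine R _ iT y dy 0 I (fun z _ => dyE z).
    by move=> z _; have := ddy z; rewrite K0 mul0r.
  by exists a, b => z; have [] := ab z I.
Qed.

(** For [c = 4 m + K] nonzero, subtracting the equilibrium [d = E / (2 c)] makes the equation
    homogeneous, and the first integral expresses [d^2] by the amplitudes: [4 C D + 1 / c] or
    [1 / c + C^2 + D^2]. This is the origin of the square roots in [kappa_sol]. *)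
Lemma kappa_sol_ode (R : realType) (m K : R) (J : set R) (v dv : R -> R)
    (E s0 : R) : is_interval J -> J s0 ->
  (forall s, J s -> 0 < v s) ->
  (forall s, J s -> is_derive s 1 v (dv s)) ->
  (forall s, J s -> is_derive s 1 dv (2 * E - 4 * (4 * m + K) * v s)) ->
  (forall s, J s ->
     dv s ^+ 2 = 4 * E * v s - 4 * (4 * m + K) * v s ^+ 2 - 4) ->
  exists C D e, (4 * m + K < 0 -> 0 <= 4 * C * D + (4 * m + K)^-1) /\
    forall s, J s -> (v s)^-1 = kappa_sol m K C D e s.
Proof.
move=> iJ Js0 v0 dvE ddv en; rewrite /kappa_sol.
move: (4 * m + K) ddv en => c ddv en; have vs0 := v0 _ Js0.
case: ltgtP => c0.
- pose w := 2 * Num.sqrt (- c).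
  have w2 : w ^+ 2 = - 4 * c.
    by rewrite /w exprMn sqr_sqrtr ?oppr_ge0 ?ltW //; ring.
  have w0 : w != 0 by rewrite mulf_neq0 ?pnatr_eq0 // gt_eqF // sqrtr_gt0
    oppr_gt0.
  have cn0 : c != 0 by rewrite lt_eqF.
  pose d := E / (2 * c).
  have [s Js|s Js|C [D CD]] :=
      @ode_hyperbolic R J iJ (fun s => v s - d) dv s0 Js0 _ w w0.
  + by have h := dvE s Js; isderive_eq; ring.
  + apply: is_derive_eq; first exact: ddv.
    by rewrite w2 /d; field.
  have dE : d ^+ 2 = 4 * C * D + c^-1.
    have [vE dvE'] := CD _ Js0; have := en _ Js0.
    have e1 : expR (w * s0) * expR (- (w * s0)) = 1 by rewrite -expRD subrr
      expR0.
    rewrite dvE' exprMn w2 -(subrK d (v s0)) vE.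
    have -> : E = 2 * c * d by rewrite /d; field.
    move: (expR (w * s0)) (expR (- (w * s0))) e1 => x y e1 e2.
    apply: (mulfI cn0); rewrite mulrDr mulfV //.
    suff : c * d ^+ 2 = 4 * c * (C * D * (x * y)) + 1 by rewrite e1 => ->; ring.
    by lra.
  (* For [c < 0] the first integral leaves the sign of [d] open; it is recorded in the boolean. *)
  exists C, D, (d < 0); split=> [_|s Js]; first by rewrite -dE sqr_ge0.
  have [vE _] := CD s Js; congr (_^-1); rewrite -/w -vE -dE sqrtr_sqr.
  have -> : (-1) ^+ (d < 0)%R * `|d| = d.
    by rewrite -numEsign.
  by rewrite subrK.
- pose w := 2 * Num.sqrt c.
  have w2 : w ^+ 2 = 4 * c.
    by rewrite /w exprMn sqr_sqrtr ?ltW //; ring.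
  have w0 : w != 0 by rewrite mulf_neq0 ?pnatr_eq0 // gt_eqF // sqrtr_gt0.
  have cn0 : c != 0 by rewrite gt_eqF.
  pose d := E / (2 * c).
  (* [4 E v = v'^2 + 4 c v^2 + 4] is positive, hence so is [E], and the nonnegative root is the
     right one. *)
  have d0 : 0 < d.
    rewrite /d divr_gt0 // ?mulr_gt0 //.
    have := en _ Js0; have := sqr_ge0 (dv s0) => h1 h2.
    have h3 : 0 <= c * v s0 ^+ 2 by rewrite mulr_ge0 ?sqr_ge0 ?ltW.
    have : 0 < E * v s0 by lra.
    by rewrite pmulr_lgt0.
  have [s Js|s Js|C [D CD]] :=
      @ode_trigonometric R J iJ (fun s => v s - d) dv s0 Js0 _ w w0.
  + by have h := dvE s Js; isderive_eq; ring.
  + apply: is_derive_eq; first exact: ddv.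
    by rewrite w2 /d; field.
  have dE : d ^+ 2 = c^-1 + (C ^+ 2 + D ^+ 2).
    have [vE dvE'] := CD _ Js0; have := en _ Js0.
    have e1 := cos2Dsin2 (w * s0).
    rewrite dvE' exprMn w2 -(subrK d (v s0)) vE.
    have -> : E = 2 * c * d by rewrite /d; field.
    move: (cos (w * s0)) (sin (w * s0)) e1 => x y e1 e2.
    apply: (mulfI cn0); rewrite mulrDr mulfV //.
    suff : c * d ^+ 2 = 1 + c * (C ^+ 2 + D ^+ 2) * (x ^+ 2 + y ^+ 2).
      by rewrite e1 mulr1.
    by lra.
  exists C, D, false; split=> // s Js.
  have [vE _] := CD s Js; congr (_^-1); rewrite -/w -vE -dE sqrtr_sqr gtr0_norm
    //.
  by rewrite subrK.
(* For [c = 0] the particular solution [E s^2] replaces the equilibrium, and the difference is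
   affine. *)
- have [s Js|s Js|a [b ab]] :=
      @ode_affine R J iJ (fun s => v s - E * s ^+ 2) (fun s => dv s - 2 * E * s)
        s0 Js0.
  + have h := dvE s Js; have hi := is_derive_id s (1 : R).
    by isderive_eq; ring.
  + have h := ddv s Js; have hi := is_derive_id s (1 : R).
    by isderive_eq; rewrite c0; ring.
  have E0 : 0 < E.
    have := en _ Js0; have := sqr_ge0 (dv s0); rewrite c0 => h1 h2.
    have : 0 < E * v s0 by lra.
    by rewrite pmulr_lgt0.
  have En0 : E != 0 by rewrite gt_eqF.
  have a2 : a ^+ 2 = 4 * E * b - 4.
    have [vE dvE'] := ab _ Js0; have := en _ Js0; rewrite c0.
    have -> : dv s0 = a + 2 * E * s0 by lra.
    have -> : v s0 = a * s0 + b + E * s0 ^+ 2 by lra.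
    by lra.
  (* Completing the square in [v = E s^2 + a s + b] with [a^2 = 4 E b - 4] gives
     [16 E v = 16 + (4 E)^2 (s + a / (2 E))^2]. *)
  exists (4 * E), (a / (2 * E)), false; split=> // s Js.
  have [vE _] := ab s Js; have vn0 : v s != 0 by rewrite gt_eqF ?v0.
  have -> : 16 + (4 * E) ^+ 2 * (s + a / (2 * E)) ^+ 2 = 16 * E * v s.
    have -> : (4 * E) ^+ 2 * (s + a / (2 * E)) ^+ 2
      = 4 * (4 * E ^+ 2 * s ^+ 2 + 4 * E * a * s + a ^+ 2) by field.
    by rewrite a2 (_ : v s = a * s + b + E * s ^+ 2); [ring|lra].
  by field; rewrite vn0 En0.
Qed.

(** * The reduced system *)

(** For [K < 0] the values at [0] and half a period later are opposite; for [K = 0] an affine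
    function of nonzero slope has a zero. *)
Lemma psi_sol_positive (R : realType) (K a b : R) :
  (forall z, 0 < psi_sol K a b z) ->
  0 < K \/ forall z z', psi_sol K a b z = psi_sol K a b z'.
Proof.
rewrite /psi_sol; case: ltgtP => K0 psi0; [|by left|right].
  have w0 : Num.sqrt (- K) != 0 by rewrite gt_eqF // sqrtr_gt0 oppr_gt0.
  have := psi0 0; have := psi0 (pi / Num.sqrt (- K)).
  rewrite (mulrCA (Num.sqrt _)) divff // mulr1 mulr0 sin0 cos0 sinpi cospi
    !mulr0 !add0r mulrN1 mulr1.
  by move=> h1 h2; have := addr_gt0 h1 h2; rewrite addNr ltxx.
have [->|a0] := eqVneq a 0; first by move=> z z'; rewrite !mul0r.
by have := psi0 (- b / a); rewrite mulrCA divff // mulr1 addNr ltxx.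
Qed.

Section ReducedSystem.
Context {R : realType} (I : set R) (m t s0 : R).
Variables k k' k'' : R -> R.
Variables f f0 f1 f00 f01 f10 f11 : R -> R -> R.
Hypothesis interval_I : is_interval I.
Hypothesis Is0 : I s0.
Hypothesis dk : forall s, I s -> is_derive s 1 k (k' s).
Hypothesis dk' : forall s, I s -> is_derive s 1 k' (k'' s).
Hypothesis df0 : forall s z : R, I s -> is_derive s 1 (f^~ z) (f0 s z).
Hypothesis df1 : forall s z : R, I s -> is_derive z 1 (f s) (f1 s z).
Hypothesis df00 : forall s z : R, I s -> is_derive s 1 (f0^~ z) (f00 s z).
Hypothesis df01 : forall s z : R, I s -> is_derive s 1 (f1^~ z) (f01 s z).
Hypothesis df10 : forall s z : R, I s -> is_derive z 1 (f0 s) (f10 s z).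
Hypothesis df11 : forall s z : R, I s -> is_derive z 1 (f1 s) (f11 s z).
Hypothesis f_gt0 : forall s z : R, I s -> 0 < f s z.
Hypothesis not_minimal : exists2 s, I s & k s != 0.

Lemma is_derive_unique (g h : R -> R) (s dg dh : R) : open I -> I s ->
  (forall r, I r -> g r = h r) ->
  is_derive s 1 g dg -> is_derive s 1 h dh -> dg = dh.
Proof.
move=> oI Is gh dgs dhs.
rewrite -(derive_val (is_derive := dgs)) -(derive_val (is_derive := dhs)).
apply: near_eq_derive; near=> r; apply: gh; near: r; exact: open_nbhs_nbhs.
Unshelve. all: by end_near. Qed.

Lemma is_derive_uniqueT (g h : R -> R) (z dg dh : R) : g =1 h ->
  is_derive z 1 g dg -> is_derive z 1 h dh -> dg = dh.
Proof.
move=> /funext-> dgz dhz.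
by rewrite -(derive_val (is_derive := dgz)) -(derive_val (is_derive := dhz)).
Qed.

(** Here [a] stands for the slope and [zeta] for the height of a horizontal lift; the three
    equations are the components of the bitension field along [X], [xi] and [V]. *)
Lemma twisted_constant (a a' zeta : R -> R) : open I -> t != 0 ->
  (forall s, I s -> is_derive s 1 a (a' s)) ->
  (forall s, I s -> is_derive s 1 zeta (- a s)) ->
  (forall s z : R, I s -> 2 * t * (f1 s z * k s)
     - 2 * k s * (f0 s z * k s + f s z * k' s - a s * (f1 s z * k s))
     - f s z * k s * k' s = 0) ->
  (forall s z : R, I s ->
     f00 s z * k s + 2 * f0 s z * k' s + f s z * k'' s
     - a s * ((f01 s z + f10 s z) * k s + 2 * f1 s z * k' s)
     + (1 + a s ^+ 2) * (f11 s z * k s) - a' s * (f1 s z * k s)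
     - f s z * k s * (k s ^+ 2 + 4 * t ^+ 2 - 4 * m) = 0) ->
  (forall s z : R, I s ->
     2 * t * (f0 s z * k s + f s z * k' s - a s * (f1 s z * k s)) = 0) ->
  forall s z : R, I s -> f s z = f s0 0.
Proof.
move=> oI t0 da dzeta eX eXi eV.
pose c s := k' s / (2 * t); pose u s z := f s z * k s.
have t20 : 2 * t != 0 by rewrite mulf_neq0 ?pnatr_eq0.
have u0E s z : I s -> f0 s z * k s + f s z * k' s = a s * (f1 s z * k s).
  move=> Is; have /eqP := eV s z Is; rewrite mulf_eq0 (negbTE t20) /=.
  by rewrite subr_eq0 => /eqP.
have u1E s z : I s -> f1 s z * k s = c s * u s z.
  move=> Is; have := eX s z Is; rewrite u0E // subrr mulr0 subr0 => h.
  by apply: (mulfI t20); rewrite /c /u; move: h; move/eqP; rewrite subr_eq0 =>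
    /eqP ->; field.
have du0 s z : I s -> is_derive s 1 (u^~ z) (a s * (c s * u s z)).
  move=> Is; have h1 := df0 z Is; have h2 := dk Is.
  by rewrite -u1E // -u0E // /u; isderive_eq; ring.
have du1 s (z : R) : I s -> is_derive z 1 (u s) (c s * u s z).
  by move=> Is; have h1 := df1 z Is; rewrite -u1E // /u; isderive_eq; ring.
have dc s : I s -> is_derive s 1 c (k'' s / (2 * t)).
  by move=> Is; have h1 := dk' Is; rewrite /c; isderive_eq; ring.
have uexp s z : I s -> u s z = u s 0 * expR (c s * z).
  move=> Is; have iT : is_interval (@setT R) by [].
  pose g z := u s z * expR (- c s * z).
  have gE : g z = g 0.
    apply: (is_derive0_interval_cst iT) => // y _.
    have h1 := du1 s y Is; have h2 := is_derive_expR_scale (- c s) y.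
    by rewrite /g; isderive_eq; ring.
  move: gE; rewrite /g mulr0 expR0 mulr1 => <-.
  by rewrite -mulrA -expRD mulNr addNr expR0 mulr1.
(* The equation [u_s = a c u] is compared at the heights [0] and [1], where [u] differs by the
   factor [expR (c s)]; the derivative of that factor must vanish unless [u] does. *)
have uc' s : I s -> u s 0 * k'' s = 0.
  move=> Is; have h0 := du0 s 0 Is; have h1 := du0 s 1 Is.
  have h2 := is_derive_comp_fct (is_derive_expR (c s)) (dc s Is).
  have := is_derive_unique (h := fun r => u r 0 * expR (c r)) oI Is _ h1.
  move=> /(_ (u s 0 * (expR (c s) * (k'' s / (2 * t)))
              + expR (c s) * (a s * (c s * u s 0)))) h.
  have {h} : a s * (c s * u s 1) = u s 0 * (expR (c s) * (k'' s / (2 * t)))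
              + expR (c s) * (a s * (c s * u s 0)).
    apply: h; last by isderive_eq; ring.
    by move=> r Ir; rewrite uexp // mulr1.
  rewrite uexp // mulr1 => h.
  have e0 : expR (c s) / (2 * t) != 0.
    by rewrite mulf_neq0 ?invr_eq0 // gt_eqF // expR_gt0.
  apply: (mulfI e0); rewrite mulr0.
  transitivity (u s 0 * (expR (c s) * (k'' s / (2 * t)))); first by ring.
  by move: h; lra.
(* [g] is [u] along the horizontal curve of height [zeta]. It is constant, so a single zero of [k]
   would force [k] to vanish identically. *)
have kn0 s : I s -> k s != 0.
  pose g s := u s 0 * expR (c s * zeta s).
  move=> Is; have gc r : I r -> g r = g s.
    move=> Ir; apply: (is_derive0_interval_cst interval_I) => // x Ix.
    have h1 := du0 x 0 Ix; have h2 := dc x Ix; have h3 := dzeta x Ix.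
    have h4 : is_derive x 1 (fun s => c s * zeta s)
      (c x * - a x + zeta x * (k'' x / (2 * t))) by isderive.
    have h5 := is_derive_comp_fct (is_derive_expR _) h4.
    rewrite /g; isderive_eq.
    transitivity (expR (c x * zeta x) * zeta x / (2 * t) * (u x 0 * k'' x)).
      by field.
    by rewrite uc' // mulr0.
  have [r Ir kr] := not_minimal; apply: contra_neq kr => ks.
  have := gc r Ir; rewrite /g /u ks mulr0 mul0r => /eqP.
  rewrite mulf_eq0 (gt_eqF (expR_gt0 _)) orbF mulf_eq0 (gt_eqF (f_gt0 _ Ir)) /=.
  by move/eqP.
have un0 s z : I s -> u s z != 0.
  by move=> Is; rewrite mulf_neq0 ?kn0 // gt_eqF ?f_gt0.
have k''0 s : I s -> k'' s = 0.
  by move=> Is; have /eqP := uc' s Is; rewrite mulf_eq0 (negbTE (un0 _ _ Is)) =>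
    /eqP.
(* As [X u = 0], the normal equation reduces to [V V u = (k^2 + 4 t^2 - 4 m) u], while
   [V V u = c^2 u]. *)
have kc s : I s -> c s ^+ 2 = k s ^+ 2 + 4 * t ^+ 2 - 4 * m.
  move=> Is; apply: (mulfI (un0 s 0 Is)).
  have hd := dc s Is; rewrite k''0 // mul0r in hd.
  have hu0 := du0 s 0 Is; have hu1 := du1 s 0 Is.
  have ha := da s Is; have hk := dk Is; have hk' := dk' Is.
  have hf0 := df0 0 Is; have hf1 := df1 0 Is.
  have h00 := df00 0 Is; have h01 := df01 0 Is.
  have h10 := df10 0 Is; have h11 := df11 0 Is.
  (* Each second derivative of [u] is computed twice: by the product rule, and from the first-order
     equations for [u]. *)
  have e00 : f00 s 0 * k s + 2 * f0 s 0 * k' s + f s 0 * k'' s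
      = a' s * (c s * u s 0) + a s * (c s * (a s * (c s * u s 0))).
    apply: (is_derive_unique (g := fun s => f0 s 0 * k s + f s 0 * k' s)
      (h := fun s => a s * (c s * u s 0)) oI Is).
    - by move=> r Ir; rewrite u0E // u1E.
    - by isderive_eq; ring.
    - by isderive_eq; ring.
  have e01 : f01 s 0 * k s + f1 s 0 * k' s = c s * (a s * (c s * u s 0)).
    apply: (is_derive_unique (g := fun s => f1 s 0 * k s)
      (h := fun s => c s * u s 0) oI Is).
    - by move=> r Ir; rewrite u1E.
    - by isderive_eq; ring.
    - by isderive_eq; ring.
  have e10 : f10 s 0 * k s + f1 s 0 * k' s = a s * (c s * (c s * u s 0)).
    apply: (is_derive_uniqueT (g := fun z => f0 s z * k s + f s z * k' s)
      (h := fun z => a s * (c s * u s z)) (z := 0)).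
    - by move=> z; rewrite u0E // u1E.
    - by isderive_eq; ring.
  have e11 : f11 s 0 * k s = c s * (c s * u s 0).
    apply: (is_derive_uniqueT (g := fun z => f1 s z * k s)
      (h := fun z => c s * u s z) (z := 0)).
    - by move=> z; rewrite u1E.
    - by isderive_eq; ring.
  have := eXi s 0 Is; rewrite e00 e11 u1E // -/(u s 0).
  have -> : (f01 s 0 + f10 s 0) * k s + 2 * f1 s 0 * k' s
    = (f01 s 0 * k s + f1 s 0 * k' s) + (f10 s 0 * k s + f1 s 0 * k' s) by ring.
  by rewrite e01 e10; lra.
(* Now [c] is constant, so differentiating [kc] gives [k k' = 0]. *)
have k'0 s : I s -> k' s = 0.
  move=> Is; have hk := dk Is; have hd := dc s Is; rewrite k''0 // mul0r in hd.
  have : 2 * c s * 0 = 2 * k s * k' s.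
    apply: (is_derive_unique (g := fun s => c s ^+ 2)
      (h := fun s => k s ^+ 2 + 4 * t ^+ 2 - 4 * m) oI Is) => //.
    - by isderive_eq; ring.
    - by isderive_eq; ring.
  move/esym/eqP; rewrite mulr0 -mulrA mulf_eq0 pnatr_eq0 /= mulf_eq0.
  by rewrite (negbTE (kn0 _ Is)) /= => /eqP.
have f1_0 s z : I s -> f1 s z = 0.
  move=> Is; have /eqP := u1E s z Is; rewrite /c k'0 // !mul0r mulf_eq0.
  by rewrite (negbTE (kn0 _ Is)) orbF => /eqP.
have f0_0 s z : I s -> f0 s z = 0.
  move=> Is; have /eqP := u0E s z Is; rewrite f1_0 // k'0 // !(mulr0, mul0r)
    addr0 mulf_eq0.
  by rewrite (negbTE (kn0 _ Is)) orbF => /eqP.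
move=> s z Is; transitivity (f s0 z).
  apply: (is_derive0_interval_cst interval_I (g := f^~ z)) => // r Ir.
  by rewrite -(f0_0 r z Ir); exact: df0.
have iT : is_interval (@setT R) by [].
apply: (is_derive0_interval_cst iT) => // r _.
by rewrite -(f1_0 s0 r Is0); exact: df1.
Qed.

(** [f^2 k^3] is conserved along the curve, and the exponent [3] is odd, so [k] has everywhere the
    sign it has at a point where it does not vanish. *)
Lemma untwisted_sign :
  (forall s z : R, I s -> k s * (2 * f0 s z * k s + 3 * f s z * k' s) = 0) ->
  exists e : bool, forall s, I s -> 0 < (-1) ^+ e * k s.
Proof.
move=> eX; pose c s := f s 0 ^+ 2 * k s ^+ 3.
have cE s r : I s -> I r -> c s = c r.
  apply: (is_derive0_interval_cst interval_I) => // x Ix.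
  have h1 := df0 0 Ix; have h2 := dk Ix.
  rewrite /c; isderive_eq.
  by transitivity (f x 0 * k x * (k x * (2 * f0 x 0 * k x + 3 * f x 0 * k' x)));
    [ring|rewrite eX // mulr0].
have [r Ir kr] := not_minimal; exists (k r < 0) => s Is.
have fs := f_gt0 0 Is; have fr := f_gt0 0 Ir.
have c3 x : I x -> ((-1) ^+ (k r < 0)%R * k x) ^+ 3 * f x 0 ^+ 2
    = (-1) ^+ (k r < 0)%R * c x.
  by move=> _; rewrite /c exprMn -exprM mulnC exprM; case: (k r < 0);
    rewrite /= ?expr0 ?expr1; ring.
have kr3 : 0 < ((-1) ^+ (k r < 0)%R * k r) ^+ 3 * f r 0 ^+ 2.
  by rewrite mulr_gt0 ?exprn_gt0 // -normrEsign normr_gt0.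
have f2 : 0 < f s 0 ^+ 2 by rewrite exprn_gt0.
by move: kr3; rewrite c3 // (cE r s) // -(c3 s) // (pmulr_lgt0 _ f2)
  exprn_odd_gt0.
Qed.

(** * Separation of variables in the untwisted case *)

Section PositiveCurvature.
Hypothesis k_gt0 : forall s, I s -> 0 < k s.
Hypothesis open_I : open I.
Hypothesis eX : forall s z : R, I s ->
  k s * (2 * f0 s z * k s + 3 * f s z * k' s) = 0.
Hypothesis eXi : forall s z : R, I s ->
  f00 s z * k s + 2 * f0 s z * k' s + f s z * k'' s + f11 s z * k s
  = f s z * k s * (k s ^+ 2 - 4 * m).

Let k_neq0 s : I s -> k s != 0. Proof. by move=> Is; rewrite gt_eqF ?k_gt0. Qed.

Let f0E s z : I s -> f0 s z = - (3 / 2) * f s z * k' s / k s.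
Proof.
move=> Is; have k0 := k_neq0 Is.
have /eqP := eX z Is; rewrite mulf_eq0 (negbTE k0) /= => /eqP h.
by apply: (mulIf k0); rewrite divfK //; lra.
Qed.

(* The value of [f_zz / f] read off the normal equation. *)
Definition sep_const s :=
  k s ^+ 2 - 4 * m - 3 / 4 * (k' s / k s) ^+ 2 + k'' s / (2 * k s).

Let f11E s z : I s -> f11 s z = f s z * sep_const s.
Proof.
move=> Is; have k0 := k_neq0 Is.
have h1 := df0 z Is; have h2 := dk Is; have h3 := dk' Is.
have e00 : f00 s z = 15 / 4 * f s z * (k' s / k s) ^+ 2
    - 3 / 2 * f s z * k'' s / k s.
  apply: (@is_derive_unique (f0^~ z)
    (fun s => - (3 / 2) * f s z * k' s / k s) s) => //.
  - by move=> r Ir; rewrite f0E.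
  - exact: df00.
  - by isderive_eq; rewrite f0E //; field.
apply: (mulIf k0); have := eXi z Is; rewrite e00 f0E // /sep_const => h.
transitivity (f s z * k s * (k s ^+ 2 - 4 * m) - (15 / 4 * f s z * (k' s / k s)
  ^+ 2
    - 3 / 2 * f s z * k'' s / k s) * k s - 2 * (- (3 / 2) * f s z * k' s / k s)
      * k' s
    - f s z * k'' s); first by rewrite -h; ring.
by field.
Qed.

Let k32 s := k s `^ (3 / 2).

Let k32_gt0 s : I s -> 0 < k32 s.
Proof. by move=> Is; rewrite powR_gt0 ?k_gt0. Qed.

Let k32_sqr s : I s -> k32 s ^+ 2 = k s ^+ 3.
Proof.
move=> Is; have k0 := ltW (k_gt0 Is).
rewrite /k32 -powR_mulrn ?powR_ge0 // -powRrM -mulrA mulVf ?pnatr_eq0 // mulr1.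
by rewrite powR_mulrn.
Qed.

(** The positive square root of the conserved quantity [f^2 k^3]. *)
Lemma separated s z : I s -> f s z * k32 s = f s0 z * k32 s0.
Proof.
move=> Is.
have cE : f s z ^+ 2 * k s ^+ 3 = f s0 z ^+ 2 * k s0 ^+ 3.
  pose c s := f s z ^+ 2 * k s ^+ 3.
  apply: (is_derive0_interval_cst interval_I (g := c)) => // x Ix.
  have h1 := df0 z Ix; have h2 := dk Ix; have k0 := k_neq0 Ix.
  by rewrite /c; isderive_eq; rewrite f0E //; field.
apply/eqP; rewrite -(@eqrXn2 _ 2) //.
- by rewrite !exprMn !k32_sqr // cE.
- by rewrite mulr_ge0 ?powR_ge0 // ltW ?f_gt0.
- by rewrite mulr_ge0 ?powR_ge0 // ltW ?f_gt0.
Qed.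

Let fE s z : I s -> f s z = k32 s0 / k32 s * f s0 z.
Proof.
move=> Is; have k0 : k32 s != 0 by rewrite gt_eqF ?k32_gt0.
by rewrite mulrAC -[k32 s0 * _]mulrC -(separated z Is) mulfK.
Qed.

(** By [separated], passing from [s0] to [s] multiplies [f] and [f_zz] by the same factor, so their
    quotient does not change. *)
Lemma sep_constE s : I s -> sep_const s = sep_const s0.
Proof.
move=> Is; have fn0 : f s 0 != 0 by rewrite gt_eqF ?f_gt0.
have f1E z : f1 s z = k32 s0 / k32 s * f1 s0 z.
  have h := df1 z Is0.
  apply: (@is_derive_uniqueT (f s) (fun z => k32 s0 / k32 s * f s0 z) z).
  - by move=> y; rewrite fE.
  - exact: df1.
have h := df11 0 Is0.
have e11 : f11 s 0 = k32 s0 / k32 s * f11 s0 0.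
  apply: (@is_derive_uniqueT (f1 s) (fun z => k32 s0 / k32 s * f1 s0 z) 0) =>
    //.
  exact: df11.
by apply: (mulfI fn0); rewrite -f11E // e11 f11E // mulrA -fE.
Qed.

Lemma untwisted_psi : exists a b, forall s z, I s ->
  f s z = psi_sol (sep_const s0) a b z * k s `^ (- (3 / 2)).
Proof.
have [z|z|a [b ab]] := @psi_sol_ode R (sep_const s0) (fun z => f s0 z * k32 s0)
    (fun z => f1 s0 z * k32 s0).
- by have h := df1 z Is0; isderive_eq; ring.
- by have h := df11 z Is0; isderive_eq; rewrite f11E //; ring.
exists a, b => s z Is; rewrite -ab -(separated z Is) powRN mulfK //.
by rewrite gt_eqF ?k32_gt0.
Qed.

Lemma untwisted_kappa : exists C D e,
  (4 * m + sep_const s0 < 0 -> 0 <= 4 * C * D + (4 * m + sep_const s0)^-1) /\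
  forall s, I s -> k s = kappa_sol m (sep_const s0) C D e s.
Proof.
pose v s := (k s)^-1; pose dv s := - k' s / k s ^+ 2.
pose c := 4 * m + sep_const s0.
pose ddv s := - k'' s / k s ^+ 2 + 2 * k' s ^+ 2 / k s ^+ 3.
have dvE s : I s -> is_derive s 1 v (dv s).
  move=> Is; have h2 := dk Is; have k0 := k_neq0 Is.
  by rewrite /v; isderive_eq; rewrite /dv; field.
have ddvE s : I s -> is_derive s 1 dv (ddv s).
  move=> Is; have h2 := dk Is; have h3 := dk' Is; have k0 := k_neq0 Is.
  have k20 : k s ^+ 2 != 0 by rewrite expf_neq0.
  by rewrite /dv; isderive_eq; rewrite /ddv; field.
have k''E s : I s -> k'' s = 2 * k s * (c - k s ^+ 2 + 3 / 4 * (k' s / k s) ^+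
  2).
  move=> Is; have k0 := k_neq0 Is; rewrite /c -(sep_constE Is) /sep_const.
  by field.
(* The first integral solved for its constant; that [E] is constant is the second-order equation for
   [k]. *)
pose E s := (dv s ^+ 2 + 4 + 4 * c * v s ^+ 2) / (4 * v s).
have EE s : I s -> E s = E s0.
  move=> Is; apply: (is_derive0_interval_cst interval_I) => // x Ix.
  have h2 := dvE x Ix; have h3 := ddvE x Ix; have k0 := k_neq0 Ix.
  have v40 : 4 * v x != 0 by rewrite mulf_neq0 ?pnatr_eq0 // invr_eq0.
  by rewrite /E; isderive_eq; rewrite /ddv k''E // /dv /v; field.
have [s Is|s Is|s Is|C [D [e [CD kE]]]] :=
    @kappa_sol_ode R m (sep_const s0) I v dv (E s0) s0 interval_I Is0 _ dvE.
- by rewrite invr_gt0 k_gt0.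
- have k0 := k_neq0 Is.
  apply: is_derive_eq; first exact: ddvE.
  by rewrite -(EE s Is) -/c /E /ddv k''E // /dv /v; field.
- by have k0 := k_neq0 Is; rewrite -(EE s Is) -/c /E /dv /v; field.
by exists C, D, e; split=> // s Is; rewrite -kE // invrK.
Qed.

(** For constant [k] the separation constant is [k^2 - 4 m], and it must be positive: otherwise
    [psi], and with it [f], would be constant. *)
Lemma untwisted_classification :
  ~ (forall s z : R, I s -> f s z = f s0 0) ->
  (exists k0, [/\ k0 != 0, forall s, I s -> k s = k0, 0 < k0 ^+ 2 - 4 * m
    & exists d1 d2 : R,
      [/\ d1 ^+ 2 + d2 ^+ 2 != 0,
          forall z, 0 < d1 * expR (z * Num.sqrt (k0 ^+ 2 - 4 * m))
                        + d2 * expR (- (z * Num.sqrt (k0 ^+ 2 - 4 * m)))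
        & forall s z, I s ->
            f s z = d1 * expR (z * Num.sqrt (k0 ^+ 2 - 4 * m))
                    + d2 * expR (- (z * Num.sqrt (k0 ^+ 2 - 4 * m)))]])
  \/ (~ constant_on I k /\ exists (K C D a b : R) (e : bool),
      [/\ 4 * m + K < 0 -> 0 <= 4 * C * D + (4 * m + K)^-1,
          forall s, I s -> k s = kappa_sol m K C D e s,
          forall z, 0 < psi_sol K a b z
        & forall s z, I s -> f s z = psi_sol K a b z * (k s `^ (- (3 / 2)))]).
Proof.
move=> fnc; have [a [b fab]] := untwisted_psi.
have [C [D [e [CD kE]]]] := untwisted_kappa.
have psi0 z : 0 < psi_sol (sep_const s0) a b z.
  by have := f_gt0 z Is0; rewrite fab // pmulr_lgt0 // powR_gt0 // k_gt0.
have [[k0 kc]|] := pselect (constant_on I k); last first.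
  by right; split=> //; exists (sep_const s0), C, D, a, b, e.
have k0_gt0 : 0 < k0 by rewrite -(kc _ Is0) k_gt0.
have k'0 s : I s -> k' s = 0.
  move=> Is; apply: (is_derive_unique (g := k) (h := fun=> k0) open_I Is) => //.
  exact: dk.
have k''0 s : I s -> k'' s = 0.
  move=> Is; apply: (is_derive_unique (g := k') (h := fun=> 0) open_I Is) => //.
  exact: dk'.
have KE : sep_const s0 = k0 ^+ 2 - 4 * m.
  by rewrite /sep_const k'0 // k''0 // kc // !mul0r expr0n /= mulr0 subr0 addr0.
have K0 : 0 < sep_const s0.
  have [//|pc] := psi_sol_positive psi0; case: fnc => s z Is.
  by rewrite !fab // !kc // (pc z 0).
pose r := k0 `^ (- (3 / 2)).
have r0 : 0 < r by rewrite powR_gt0.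
have fexp s z : I s -> f s z = a * r * expR (z * Num.sqrt (k0 ^+ 2 - 4 * m))
    + b * r * expR (- (z * Num.sqrt (k0 ^+ 2 - 4 * m))).
  move=> Is; rewrite fab // kc // /psi_sol ltNge (ltW K0) (gt_eqF K0) /= KE.
  by rewrite [z * _]mulrC -/r; ring.
left; exists k0; split=> //; rewrite -?KE ?gt_eqF //.
exists (a * r), (b * r); rewrite KE; split=> //.
  apply/negP => ab0; have := f_gt0 0 Is0; rewrite fexp //.
  move: ab0; rewrite paddr_eq0 ?sqr_ge0 // !sqrf_eq0 => /andP[/eqP-> /eqP->].
  by rewrite !mul0r addr0 ltxx.
by move=> z; rewrite -(fexp s0) // f_gt0.
Qed.

End PositiveCurvature.

End ReducedSystem.

(** * Curves, horizontal lifts and mean curvature *)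

Section HopfCylinder.
Context {R : realType} (m l : R) (I : set R) (gamma : R -> 'rV[R]_2).
Hypothesis open_I : open I.
Hypothesis gamma_arclength : arclength_curve m I gamma.

Definition jet (i : 'I_2) n (s : R) :=
  iter n (fun g : R -> 'rV[R]_2 => 'D_1 g) gamma s 0 i.
Local Notation x := (jet 0).
Local Notation y := (jet 1).
Local Notation h := (bcv_metric m l).
Local Notation k := (curv m (x 0) (y 0) (x 1) (y 1) (x 2) (y 2)).
Local Notation frm := (frame m l (x 0) (y 0) (x 1) (y 1)).

Lemma is_derive_jet i n (s : R) : I s -> is_derive s 1 (jet i n) (jet i n.+1 s).
Proof.
move=> Is; have [sg _ _] := gamma_arclength.
suff sn : smooth_on I (iter n (fun g : R -> 'rV[R]_2 => 'D_1 g) gamma).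
  by have /is_derive_mxP := smooth_on_is_derive (1 : R) sn Is; exact.
by elim: n => [|n IHn] //=; exact: smooth_on_derive.
Qed.

Lemma jet_factor_gt0 s : I s -> 0 < bcv_factor m (x 0 s) (y 0 s).
Proof. by have [_ F0 _] := gamma_arclength; exact: F0. Qed.

Lemma jet_unit_speed s : I s ->
  (x 1 s ^+ 2 + y 1 s ^+ 2) / bcv_factor m (x 0 s) (y 0 s) ^+ 2 = 1.
Proof.
move=> Is; have [_ _ /(_ s Is) <-] := gamma_arclength.
rewrite /inner /bcv_base_metric derive1E mxE sum_ord2 !mxE !sum_ord2 !mxE /=.
by rewrite /jet /= !mulr1n !mulr0n; ring.
Qed.

Let dx0 := @is_derive_jet 0 0. Let dy0 := @is_derive_jet 1 0.
Let dx1 := @is_derive_jet 0 1. Let dy1 := @is_derive_jet 1 1.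

Lemma hopf_cylinderE : hopf_cylinder gamma = cyl (x 0) (y 0).
Proof. by []. Qed.

Lemma mean_curvature_cyl s z : I s ->
  mean_curvature h (hopf_cylinder gamma) (vec2 s z) = `|k s| / 2.
Proof.
move=> Is; have Uq : hopf_domain I (vec2 s z) by rewrite /hopf_domain /= vec2E.
(* The induced metric is the case [f = 1] of the conformal one, where the tension field is
   [k xi]. *)
have g1 : pullback_metric h (hopf_cylinder gamma) =
    conformal_metric (fun=> 1) (pullback_metric h (cyl (x 0) (y 0))).
  by apply/funext => q; rewrite /conformal_metric invr1 scale1r.
rewrite /mean_curvature g1 hopf_cylinderE.
have d1 (q v : 'rV[R]_2) : hopf_domain I q ->
    is_derive q v (fun=> 1 : R) (v 0 0 * 0 + v 0 1 * 0).
  by move=> _; isderive_eq; ring.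
rewrite (tension_cyl l open_I dx0 dy0 dx1 dy1 jet_factor_gt0 jet_unit_speed
  (fun _ _ => ltr01) d1 Uq).
rewrite frameZ vec2E (inner_frame l jet_unit_speed) //; first last.
- by rewrite cyl_y vec2E.
- by rewrite cyl_x vec2E.
rewrite !mulr0 add0r addr0 mul1r -expr2 sqrtr_sqr normrM.
by rewrite ger0_norm ?invr_ge0 // mulrC.
Qed.

Variable gammah : R -> 'rV[R]_3.
Hypothesis gammah_lift : horizontal_lift m l I gamma gammah.

Lemma lift_coord s : I s -> gammah s 0 0 = x 0 s /\ gammah s 0 1 = y 0 s.
Proof.
move=> Is; have [_ /(_ s Is) pE _] := gammah_lift; rewrite /jet /= -pE.
by rewrite /bcv_proj !vec2E.
Qed.

(** The projection determines two components of the velocity and horizontality the third: the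
    velocity is [X]. *)
Lemma is_derive_lift (s : R) : I s -> is_derive s 1 gammah (frm s 1 0 0).
Proof.
move=> Is; have [sg _ /(_ s Is) hor] := gammah_lift.
have [px py] := lift_coord Is.
have dg := smooth_on_is_derive (1 : R) sg Is.
suff <- : 'D_1 gammah s = frm s 1 0 0 by [].
have /is_derive_mxP dgc := dg.
have e0 : 'D_1 gammah s 0 0 = x 1 s.
  apply: (is_derive_unique (g := fun s => gammah s 0 0) (h := x 0) open_I Is) =>
    //.
    by move=> r Ir; have [] := lift_coord Ir.
  exact: dx0.
have e1 : 'D_1 gammah s 0 1 = y 1 s.
  apply: (is_derive_unique (g := fun s => gammah s 0 1) (h := y 0) open_I Is) =>
    //.
    by move=> r Ir; have [] := lift_coord Ir.
  exact: dy0.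
move: hor; rewrite derive1E inner_bcv /contact !vec3E e0 e1 px py.
rewrite !(mulr0, subr0, mul0r, add0r, mulr1) => hor.
apply: row3P; rewrite /frame !vec3E ?e0 ?e1; [ring|ring|].
by move: hor; lra.
Qed.

(** Provides the function [zeta] of [twisted_constant]. *)
Lemma is_derive_lift_height (s : R) : I s ->
  is_derive s 1 (fun s => gammah s 0 2) (- slope m l (x 0) (y 0) (x 1) (y 1) s).
Proof.
move=> Is; have /is_derive_mxP/(_ 0 2) := is_derive_lift Is.
by rewrite /frame vec3E => d; apply: is_derive_eq; rewrite /slope; ring.
Qed.

Lemma geodesic_curvature_lift s : I s -> geodesic_curvature h gammah s = `|k s|.
Proof.
move=> Is; have [px py] := lift_coord Is; rewrite /geodesic_curvature.
have WE : \forall r \near s, frm r 1 0 0 = derive1 gammah r.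
  near=> r; have Ir : I r by near: r; exact: open_nbhs_nbhs.
  by rewrite derive1E (derive_val (is_derive := is_derive_lift Ir)).
(* The structure equations are applied to a one-dimensional domain, with velocity [X] and field [X];
   only [k xi] remains. *)
rewrite (@nabla_along_frame _ m l I (x 0) (y 0) (x 1) (y 1) (x 2) (y 2) open_I
  dx0 dy0 dx1 dy1 jet_factor_gt0 jet_unit_speed _ gammah (fun=> 1) _ id
  (fun=> 1) (fun=> 0) (fun=> 0) s 1 1 0 0 0 0 Is px py (erefl _)
  (is_derive_lift Is) (is_derive_id _ _) (is_derive_fct_cst _ _ _)
  (is_derive_fct_cst _ _ _) (is_derive_fct_cst _ _ _) WE).
rewrite (inner_frame l jet_unit_speed) //=.
by rewrite !(mul0r, mulr0, mul1r, add0r, addr0, subr0) -expr2 sqrtr_sqr.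
Unshelve. all: by end_near. Qed.

End HopfCylinder.

(** * From the vanishing bitension field to the reduced system *)

Theorem theorem3p2 (R : realType) (m l : R) (I : set R)
    (gamma : R -> 'rV[R]_2) (gammah : R -> 'rV[R]_3) (kappa : R -> R)
    (f : 'rV[R]_2 -> R)
    (open_I : open I) (interval_I : is_interval I)
    (gamma_arclength : arclength_curve m I gamma)
    (gammah_lift : horizontal_lift m l I gamma gammah)
    (kappaE : forall s, I s ->
       kappa s = geodesic_curvature (bcv_metric m l) gammah s)
    (f_smooth : smooth_on (hopf_domain I) f)
    (f_gt0 : forall q, hopf_domain I q -> 0 < f q)
    (phi_proper_biharmonic :
       proper_biharmonic_on (hopf_domain I)
         (conformal_metric f
            (pullback_metric (bcv_metric m l) (hopf_cylinder gamma)))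
         (bcv_metric m l) (hopf_cylinder gamma))
    (conformal_factor_nonconstant :
       ~ constant_on (hopf_domain I) (fun q => Num.sqrt (f q))) :
  let H := mean_curvature (bcv_metric m l) (hopf_cylinder gamma) in
  l = 0 /\
  ((exists kappa0 : R,
      [/\ kappa0 != 0,
          forall s, I s -> kappa s = kappa0,
          forall s z, I s -> H (vec2 s z) = kappa s / 2,
          0 < kappa0 ^+ 2 - 4 * m
        & exists d1 d2 : R,
            [/\ d1 ^+ 2 + d2 ^+ 2 != 0,
                forall z,
                  0 < d1 * expR (z * Num.sqrt (kappa0 ^+ 2 - 4 * m))
                      + d2 * expR (- (z * Num.sqrt (kappa0 ^+ 2 - 4 * m)))
              & forall s z, I s ->
                  f (vec2 s z) =
                    d1 * expR (z * Num.sqrt (kappa0 ^+ 2 - 4 * m))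
                    + d2 * expR (- (z * Num.sqrt (kappa0 ^+ 2 - 4 * m)))]])
   \/
   [/\ ~ constant_on (hopf_domain I) H,
       forall s z, I s -> H (vec2 s z) = kappa s / 2
     & exists (K C D a b : R) (e : bool),
         [/\ 4 * m + K < 0 -> 0 <= 4 * C * D + (4 * m + K)^-1,
             forall s, I s -> kappa s = kappa_sol m K C D e s,
             ~ constant_on I kappa /\ (forall s, I s -> 0 < kappa s),
             forall z, 0 < psi_sol K a b z
           & forall s z, I s ->
               f (vec2 s z) = psi_sol K a b z * (kappa s `^ (- (3 / 2)))]]).
Proof.
move=> H; have [biharm nharm] := phi_proper_biharmonic.
pose x := jet gamma 0; pose y := jet gamma 1.
pose dx n := is_derive_jet gamma_arclength 0 n.
pose dy n := is_derive_jet gamma_arclength 1 n.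
have F0 := jet_factor_gt0 gamma_arclength.
have us := jet_unit_speed gamma_arclength.
pose k := curv m (x 0) (y 0) (x 1) (y 1) (x 2) (y 2).
pose k' := curv' m (x 0) (y 0) (x 1) (y 1) (x 2) (y 2) (x 3) (y 3).
pose a := slope m l (x 0) (y 0) (x 1) (y 1).
pose a' := slope' m l (x 0) (y 0) (x 1) (y 1) (x 2) (y 2).
pose e0 : 'rV[R]_2 := delta_mx 0 0; pose e1 : 'rV[R]_2 := delta_mx 0 1.
have dk s (Is : I s) : is_derive s 1 k (k' s).
  exact: (is_derive_curv (dx 0%N) (dy 0%N) (dx 1%N) (dy 1%N) (dx 2%N) (dy 2%N)).
have dk' s (Is : I s) : is_derive s 1 k' ('D_1 k' s).
  apply: derivableP; exact: (derivable_curv' (dx 0%N) (dy 0%N) (dx 1%N) (dy 1%N)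
    (dx 2%N) (dy 2%N) (dx 3%N) (dy 3%N) F0).
have sf0 := smooth_on_derive e0 f_smooth.
have sf1 := smooth_on_derive e1 f_smooth.
have df q v Uq := smooth_on_is_derive2 open_I (q := q) v f_smooth Uq.
have df0 q v Uq := smooth_on_is_derive2 open_I (q := q) v sf0 Uq.
have df1 q v Uq := smooth_on_is_derive2 open_I (q := q) v sf1 Uq.
have Uv s z : I s -> hopf_domain I (vec2 s z) by rewrite /hopf_domain /= vec2E.
have kappa_abs s : I s -> kappa s = `|k s|.
  move=> Is; rewrite kappaE //.
  exact: (geodesic_curvature_lift open_I gamma_arclength gammah_lift Is).
have HE s z : I s -> H (vec2 s z) = kappa s / 2.
  move=> Is; rewrite kappa_abs //.
  exact: (mean_curvature_cyl l open_I gamma_arclength z Is).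
have not_minimal : exists2 s, I s & k s != 0.
  apply: contrapT => kn0; apply: nharm => q Uq.
  have kq : k (q 0 0) = 0 by apply/eqP/negPn/negP => kq; apply: kn0; exists (q 0
    0).
  rewrite hopf_cylinderE (tension_cyl l open_I (dx 0%N) (dy 0%N) (dx 1%N) (dy
    1%N)
    F0 us f_gt0 df Uq) -/k kq mulr0.
  by apply: row3P; rewrite /frame !vec3E mxE; ring.
have [s0 Is0 ks0] := not_minimal.
pose ff s z := f (vec2 s z).
have ff_gt0 s z : I s -> 0 < ff s z by move=> Is; rewrite f_gt0 //; exact: Uv.
have nconst : ~ (forall s z, I s -> ff s z = ff s0 0).
  move=> fc; apply: conformal_factor_nonconstant; exists (Num.sqrt (ff s0 0)) =>
    q Uq.
  by rewrite [in LHS](row2_vec2 q) -(fc (q 0 0) (q 0 1)).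
have dl (G : 'rV[R]_2 -> R) s z (sG : smooth_on (hopf_domain I) G) (Is : I s) :=
  is_derive_curve2l (smooth_on_is_derive e0 sG (Uv s z Is)).
have dr (G : 'rV[R]_2 -> R) s z (sG : smooth_on (hopf_domain I) G) (Is : I s) :=
  is_derive_curve2r (smooth_on_is_derive e1 sG (Uv s z Is)).
pose fs s z : R := 'D_e0 f (vec2 s z); pose fz s z : R := 'D_e1 f (vec2 s z).
pose fss s z : R := 'D_e0 ('D_e0 f) (vec2 s z).
pose fsz s z : R := 'D_e0 ('D_e1 f) (vec2 s z).
pose fzs s z : R := 'D_e1 ('D_e0 f) (vec2 s z).
pose fzz s z : R := 'D_e1 ('D_e1 f) (vec2 s z).
have dfs (s z : R) (Is : I s) : is_derive s 1 (ff^~ z) (fs s z) := dl f s z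
  f_smooth Is.
have dfz (s z : R) (Is : I s) : is_derive z 1 (ff s) (fz s z) := dr f s z
  f_smooth Is.
have dfss (s z : R) (Is : I s) : is_derive s 1 (fs^~ z) (fss s z) := dl _ s z
  sf0 Is.
have dfsz (s z : R) (Is : I s) : is_derive s 1 (fz^~ z) (fsz s z) := dl _ s z
  sf1 Is.
have dfzs (s z : R) (Is : I s) : is_derive z 1 (fs s) (fzs s z) := dr _ s z sf0
  Is.
have dfzz (s z : R) (Is : I s) : is_derive z 1 (fz s) (fzz s z) := dr _ s z sf1
  Is.
have eqs s z : I s -> let t := l / 2 in let u := ff s z * k s in
  let u0 := fs s z * k s + ff s z * k' s in let u1 := fz s z * k s in
  [/\ 2 * t * u1 - 2 * k s * (u0 - a s * u1) - u * k' s = 0,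
      fss s z * k s + 2 * fs s z * k' s + ff s z * 'D_1 k' s
     - a s * ((fsz s z + fzs s z) * k s + 2 * fz s z * k' s)
     + (1 + a s ^+ 2) * (fzz s z * k s) - a' s * u1
     - u * (k s ^+ 2 + 4 * t ^+ 2 - 4 * m) = 0
    & 2 * t * (u0 - a s * u1) = 0].
  move=> Is t u u0 u1; have Uq := Uv s z Is.
  have := biharm _ Uq; rewrite hopf_cylinderE.
  rewrite (bitension_cyl l open_I (dx 0%N) (dy 0%N) (dx 1%N) (dy 1%N) (dx 2%N)
    (dy 2%N) F0 us f_gt0 df df0 df1 dk' Uq) vec2E => /eqP.
  rewrite scaler_eq0 gt_eqF ?f_gt0 //= => /eqP.
  exact: (frame_eq0 F0 us Is).
clearbody fs fz fss fsz fzs fzz.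
have [l0|l_neq0] := eqVneq l 0; last first.
  have t0 : l / 2 != 0 by rewrite mulf_neq0 ?invr_eq0 ?pnatr_eq0.
  have da s (Is : I s) := is_derive_slope l (dx 0%N) (dy 0%N) (dx 1%N) (dy 1%N)
    F0 Is.
  have dh s (Is : I s) := is_derive_lift_height open_I gamma_arclength
    gammah_lift Is.
  case: nconst; exact: (twisted_constant interval_I Is0 dk dk' dfs dfz dfss dfsz
    dfzs
    dfzz ff_gt0 not_minimal open_I t0 da dh
    (fun s z Is => let: And3 h _ _ := eqs s z Is in h)
    (fun s z Is => let: And3 _ h _ := eqs s z Is in h)
    (fun s z Is => let: And3 _ _ h := eqs s z Is in h)).
split=> //.
have a0 s : a s = 0 by rewrite /a /slope l0 !mul0r.
have a'0 s : a' s = 0 by rewrite /a' /slope' -/(a s) a0 l0 !mul0r subrr.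
have eX s z : I s -> k s * (2 * fs s z * k s + 3 * ff s z * k' s) = 0.
  move=> Is; have [+ _ _] := eqs s z Is; rewrite l0 a0.
  move: (k s) (k' s) (fs s z) (fz s z) (ff s z) => *; lra.
have eXi s z : I s -> fss s z * k s + 2 * fs s z * k' s
    + ff s z * 'D_1 k' s + fzz s z * k s
    = ff s z * k s * (k s ^+ 2 - 4 * m).
  move=> Is; have [_ + _] := eqs s z Is; rewrite l0 a0 a'0.
  move: (k s) (k' s) ('D_1 k' s) (fs s z) (fz s z) (ff s z) => *; lra.
have [e ek] := untwisted_sign interval_I dk dfs ff_gt0 not_minimal eX.
(* The reduced system is invariant under [k -> - k], so it also holds for [c * k], which is the
   positive function [kappa]. *)
pose c : R := (-1) ^+ e.
have c2 : c ^+ 2 = 1 by rewrite /c -exprM mulnC exprM sqrrN !expr1n.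
have kappa_c s : I s -> kappa s = c * k s.
  move=> Is; rewrite kappa_abs //.
  by rewrite -[RHS]gtr0_norm ?ek // normrM /c normrX normrN1 expr1n mul1r.
have dck (s : R) : I s -> is_derive s 1 (fun s => c * k s) (c * k' s).
  by move=> Is; have h := dk s Is; isderive_eq; ring.
have dck' (s : R) : I s -> is_derive s 1 (fun s => c * k' s) (c * 'D_1 k' s).
  by move=> Is; have h := dk' s Is; isderive_eq; ring.
have eXc s z : I s ->
    c * k s * (2 * fs s z * (c * k s) + 3 * ff s z * (c * k' s)) = 0.
  move=> Is; transitivity (c ^+ 2 * (k s * (2 * fs s z * k s + 3 * ff s z * k'
    s))).
    by move: (k' s) => *; ring.
  by rewrite eX // mulr0.
have eXic s z : I s -> fss s z * (c * k s) + 2 * fs s z * (c * k' s)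
    + ff s z * (c * 'D_1 k' s) + fzz s z * (c * k s)
    = ff s z * (c * k s) * ((c * k s) ^+ 2 - 4 * m).
  move=> Is; rewrite exprMn c2 mul1r.
  transitivity (c * (ff s z * k s * (k s ^+ 2 - 4 * m))); last by ring.
  by rewrite -eXi //; move: (k' s) ('D_1 k' s) => *; ring.
have [[kap0 [kap0_neq0 kc K0 [d1 [d2 [d_neq0 fpos fE]]]]]|
      [knc [K [C [D [b1 [b2 [e' [CD kE psi0 fE]]]]]]]]] :=
  untwisted_classification interval_I Is0 dck dck' dfs dfz dfss dfzz ff_gt0 ek
    open_I
    eXc eXic nconst.
  left; exists kap0; split=> //; first by move=> s Is; rewrite kappa_c ?kc.
  by exists d1, d2; split.
right; split=> //.
  move=> [r Hr]; apply: knc; exists (2 * r) => s Is.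
  by rewrite -kappa_c // -(Hr (vec2 s 0)) ?HE //; [field|exact: Uv].
exists K, C, D, b1, b2, e'; split=> //.
- by move=> s Is; rewrite kappa_c // kE.
- split; last by move=> s Is; rewrite kappa_c // ek.
  by move=> [r Hr]; apply: knc; exists r => s Is; rewrite -kappa_c // Hr.
- by move=> s z Is; rewrite kappa_c // -fE.
Qed.
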